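(* Let $(X,\mu)$ be a probability space, let $G$ be a group, and let $1\le p_0<\infty$. Suppose that $G$ acts on $\mathrm{L}^{p_0}(X,\mu)$ as isometric lattice automorphisms that leave the constants fixed. Then $G$ acts naturally on $\mathrm{L}^p(X,\mu)$ as isometric lattice automorphisms that leave the constants fixed for all $1\le p<\infty$. These representation spaces $\mathrm{L}^p(X,\mu)$ $(1\le p<\infty)$ are either all separable, or all non-separable. If $G$ is a topological group, then these representations are either all strongly continuous or all not strongly continuous, and likewise they are either all weakly continuous or all not weakly continuous.
   Context: All spaces are real; functions equal almost everywhere are identified. ''Acts naturally'' means: each operator $\rho^{p_0}(g)$ of the given representation leaves $\mathrm{L}^\infty(X,\mu)$ invariant, and for each $1\le p<\infty$ the operator $\rho^p(g)$ on $\mathrm{L}^p(X,\mu)$ is the unique bounded operator agreeing with $\rho^{p_0}(g)$ on $\mathrm{L}^\infty(X,\mu)$. A representation $\rho$ of a topological group on a Banach space is strongly (resp. weakly) continuous if it is continuous for the strong (resp. weak) operator topology. *)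

(* Defs.v *)
From HB Require Import structures.
From mathcomp Require Import all_boot all_order all_algebra.
From mathcomp Require Import all_classical all_reals all_analysis.
From mathcomp Require Import ess_sup_inf measurable_realfun.
Set Implicit Arguments.
Unset Strict Implicit.
Unset Printing Implicit Defensive.
Import Order.TTheory GRing.Theory Num.Def Num.Theory.
Import numFieldNormedType.Exports.
Local Open Scope classical_set_scope.
Local Open Scope ring_scope.

(* LspaceType mu p1 is the type of classes, modulo a.e. equality, of measurable
   functions with finite L^p-norm; a class coerces to a chosen representative.
   It is equipped here with its normed module and lattice structures: all
   operations are computed on representatives (Lrep) and then projected to the
   quotient (Lclass). The order is a.e. inequality. *)
Section Lspace_class.
Context d (T : measurableType d) (R : realType).
Variables (mu : {measure set T -> \bar R}) (p : \bar R) (p1 : (1 <= p)%E).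
Local Notation L := (LspaceType mu p1).
Local Open Scope quotient_scope.

Lemma ae_eq_Lnorm (f g : T -> R) :
  measurable_fun setT f -> measurable_fun setT g -> f = g %[ae mu] ->
  ('N[mu]_p[EFin \o f] = 'N[mu]_p[EFin \o g])%E.
Proof.
move=> mf mg fg; rewrite unlock; case: p p1 => [r r1|_|//]; last first.
  case: ifPn => // _; apply: eq_ess_sup.
  by apply: filterS fg => x /= ->.
have mpow (h : T -> R) : measurable_fun setT h ->
    measurable_fun setT (fun x => (`|(EFin \o h) x| `^ r)%E).
  move=> mh; apply: (@measurableT_comp _ _ _ _ _ _ (fun x => (x `^ r)%E)) => //.
    exact: measurable_poweR.
  by apply: measurableT_comp => //; exact/measurable_EFinP.
congr (_ `^ _)%E; apply: ae_eq_integral => //; do ?exact: mpow.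
by apply: filterS fg => x /= ->.
Qed.

Lemma Lspace_inj (f g : L) :
  (f : {mfun_ mu, T >-> measurableTypeR R}) = g -> f = g.
Proof.
case: f g => [f [[fi]]] [g [[gi]]] /= fg; subst g.
by rewrite (bool_irrelevance fi gi).
Qed.

Lemma Lspace_eqP (f g : L) : f = g <-> (f : T -> R) = g %[ae mu].
Proof.
split=> [->|fg]; first exact: ae_eq_refl.
by apply: Lspace_inj; rewrite -[LHS]reprK -[RHS]reprK; exact/eqmodP/asboolP.
Qed.

Lemma measurable_Lspace (f : L) : measurable_fun setT (f : T -> R).
Proof. exact: measurable_funPT (repr (f : {mfun_ mu, T >-> measurableTypeR R})). Qed.

Lemma Lspace_Lfun (f : L) : (f : T -> R) \in Lfun mu p.
Proof.
rewrite inE; apply/andP; split; rewrite inE; first exact: measurable_Lspace.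
exact: Lebesgue_finite.
Qed.

Definition Lrep (f : L) : LfunType mu p1 := Lfun_Sub p1 (Lspace_Lfun f).

(* measurableTypeR R and R carry the same sigma-algebra but are distinct
   measurable types for unification. *)
Definition mfunR (F : LfunType mu p1) : T -> measurableTypeR R := F.
Lemma measurable_mfunR F : measurable_fun setT (mfunR F).
Proof. exact: (measurable_funPT (F : {mfun T >-> R})). Qed.
HB.instance Definition _ F :=
  @isMeasurableFun.Build _ _ T (measurableTypeR R) (mfunR F)
    (measurable_mfunR F).
Definition pi_mfun F : {mfun_ mu, T >-> measurableTypeR R} :=
  \pi_({mfun_ mu, T >-> measurableTypeR R}) (mfunR F).

Lemma pi_mfunE F : (pi_mfun F : T -> R) = F %[ae mu].
Proof.
suff /eqmodP/asboolP : repr (pi_mfun F) = mfunR F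
    %[mod {mfun_ mu, T >-> measurableTypeR R}] by [].
exact: reprK.
Qed.

Lemma pi_mfun_finite F : finite_norm mu p (pi_mfun F).
Proof.
rewrite /finite_norm (ae_eq_Lnorm _ _ (pi_mfunE F)); first exact: Lfunction_finite.
  exact: (measurable_funPT (repr (pi_mfun F))).
exact: (measurable_funPT (F : {mfun T >-> R})).
Qed.

HB.instance Definition _ F :=
  @isFinLebesgue.Build d T R mu p p1 (pi_mfun F) (pi_mfun_finite F).

Definition Lclass (F : LfunType mu p1) : L := pi_mfun F.

Lemma LclassE F : (Lclass F : T -> R) = F %[ae mu].
Proof. exact: pi_mfunE. Qed.

HB.instance Definition _ := gen_eqMixin L.
HB.instance Definition _ := gen_choiceMixin L.

Lemma Lfun_abs (F : LfunType mu p1) : normr \o (F : T -> R) \in Lfun mu p.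
Proof.
rewrite inE; apply/andP; split; rewrite inE /=.
  by apply: measurableT_comp => //; exact: (measurable_funPT (F : {mfun T >-> R})).
rewrite /finite_norm (_ : EFin \o _ = abse \o (EFin \o (F : T -> R)))%E //.
by rewrite Lnorm_abse; exact: Lfunction_finite.
Qed.

Lemma Lfun_max (F G : LfunType mu p1) :
  (fun x => Num.max (F x) (G x)) \in Lfun mu p.
Proof.
rewrite (_ : (fun x => _) = (2^-1 *: (F + G + Lfun_Sub p1 (Lfun_abs (F - G))) :
  LfunType mu p1)); first exact: LfunP.
by apply/funext => x /=; rewrite maxr_absE mulrC.
Qed.

Lemma Lfun_min (F G : LfunType mu p1) :
  (fun x => Num.min (F x) (G x)) \in Lfun mu p.
Proof.
rewrite (_ : (fun x => _) = (2^-1 *: (F + G - Lfun_Sub p1 (Lfun_abs (F - G))) :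
  LfunType mu p1)); first exact: LfunP.
by apply/funext => x /=; rewrite minr_absE mulrC.
Qed.

Definition Lzero : L := Lclass 0.
Definition Lopp (f : L) : L := Lclass (- Lrep f).
Definition Ladd (f g : L) : L := Lclass (Lrep f + Lrep g).
Definition Lscale (a : R) (f : L) : L := Lclass (a *: Lrep f).
Definition Ljoin (f g : L) : L :=
  Lclass (Lfun_Sub p1 (Lfun_max (Lrep f) (Lrep g))).
Definition Lmeet (f g : L) : L :=
  Lclass (Lfun_Sub p1 (Lfun_min (Lrep f) (Lrep g))).
Definition Lle (f g : L) : bool := `[< \forall x \ae mu, f x <= g x >].
Definition Llt (f g : L) : bool := (g != f) && Lle f g.
Definition Lspace_norm (f : L) : R := fine ('N[mu]_p[EFin \o f])%E.

Lemma Lclass_ae F : \forall x \ae mu, Lclass F x = F x.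
Proof. by apply: filterS (LclassE F) => x /(_ I). Qed.
Lemma LzeroE : \forall x \ae mu, Lzero x = 0.
Proof. exact: Lclass_ae. Qed.
Lemma LoppE f : \forall x \ae mu, Lopp f x = - f x.
Proof. exact: Lclass_ae. Qed.
Lemma LaddE f g : \forall x \ae mu, Ladd f g x = f x + g x.
Proof. exact: Lclass_ae. Qed.
Lemma LscaleE a f : \forall x \ae mu, Lscale a f x = a * f x.
Proof. exact: Lclass_ae. Qed.
Lemma LjoinE f g : \forall x \ae mu, Ljoin f g x = Num.max (f x) (g x).
Proof. exact: Lclass_ae. Qed.
Lemma LmeetE f g : \forall x \ae mu, Lmeet f g x = Num.min (f x) (g x).
Proof. exact: Lclass_ae. Qed.


Lemma Lspace_ae (f g : L) : (\forall x \ae mu, f x = g x) -> f = g.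
Proof. by move=> fg; apply/Lspace_eqP; apply: filterS fg. Qed.

Lemma LaddA : associative Ladd.
Proof.
move=> f g h; apply: Lspace_ae; near=> x.
rewrite (near (LaddE f (Ladd g h)) x) // (near (LaddE g h) x) //.
rewrite (near (LaddE (Ladd f g) h) x) // (near (LaddE f g) x) //.
by rewrite addrA.
Unshelve. all: by end_near. Qed.

Lemma LaddC : commutative Ladd.
Proof.
move=> f g; apply: Lspace_ae; near=> x.
rewrite (near (LaddE f g) x) // (near (LaddE g f) x) //.
by rewrite addrC.
Unshelve. all: by end_near. Qed.

Lemma Ladd0f : left_id Lzero Ladd.
Proof.
move=> f; apply: Lspace_ae; near=> x.
rewrite (near (LaddE Lzero f) x) // (near LzeroE x) //.
by rewrite add0r.
Unshelve. all: by end_near. Qed.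

Lemma LaddNf : left_inverse Lzero Lopp Ladd.
Proof.
move=> f; apply: Lspace_ae; near=> x.
rewrite (near (LaddE (Lopp f) f) x) // (near (LoppE f) x) // (near LzeroE x) //.
by rewrite addNr.
Unshelve. all: by end_near. Qed.

HB.instance Definition _ := GRing.isZmodule.Build L LaddA LaddC Ladd0f LaddNf.

Lemma LscaleA a b f : Lscale a (Lscale b f) = Lscale (a * b) f.
Proof.
apply: Lspace_ae; near=> x.
rewrite (near (LscaleE a (Lscale b f)) x) // (near (LscaleE b f) x) //.
rewrite (near (LscaleE (a * b) f) x) //.
by rewrite mulrA.
Unshelve. all: by end_near. Qed.

Lemma Lscale1 : left_id 1 Lscale.
Proof.
by move=> f; apply: Lspace_ae; apply: filterS (LscaleE 1 f) => x ->; rewrite mul1r.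
Qed.

Lemma LscaleDr : right_distributive Lscale +%R.
Proof.
move=> a f g; apply: Lspace_ae; near=> x.
rewrite (near (LscaleE a (f + g)) x) // (near (LaddE f g) x) //.
rewrite (near (LaddE (Lscale a f) (Lscale a g)) x) //.
rewrite (near (LscaleE a f) x) // (near (LscaleE a g) x) //.
by rewrite mulrDr.
Unshelve. all: by end_near. Qed.

Lemma LscaleDl f : {morph Lscale^~ f : a b / a + b}.
Proof.
move=> a b; apply: Lspace_ae; near=> x.
rewrite (near (LscaleE (a + b) f) x) //.
rewrite (near (LaddE (Lscale a f) (Lscale b f)) x) //.
rewrite (near (LscaleE a f) x) // (near (LscaleE b f) x) //.
by rewrite mulrDl.
Unshelve. all: by end_near. Qed.

HB.instance Definition _ :=
  GRing.Zmodule_isLmodule.Build R L LscaleA Lscale1 LscaleDr LscaleDl.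

Lemma Lspace_normE (F : LfunType mu p1) :
  Lspace_norm (Lclass F) = fine ('N[mu]_p[EFin \o F])%E.
Proof.
congr fine; apply: ae_eq_Lnorm; last exact: LclassE.
  exact: measurable_Lspace.
exact: (measurable_funPT (F : {mfun T >-> R})).
Qed.

Lemma Lspace_normD f g : Lspace_norm (f + g) <= Lspace_norm f + Lspace_norm g.
Proof. by rewrite Lspace_normE; exact: (ler_LnormD (Lrep f) (Lrep g)). Qed.

Lemma Lspace_normZ a f : Lspace_norm (a *: f) = `|a| * Lspace_norm f.
Proof.
rewrite Lspace_normE; apply: EFin_inj.
rewrite (finite_norm_fine (a *: Lrep f)) EFinM (finite_norm_fine (Lrep f)).
exact: (LnormZ (Lrep f) a).
Qed.

Lemma Lspace_norm0_eq0 f : Lspace_norm f = 0 -> f = 0.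
Proof.
move=> /(@fine_Lnormr_eq0 _ _ _ mu p p1 (Lrep f)) f0; apply: Lspace_ae.
by apply: filterS2 f0 LzeroE => x /(_ I) /= -> ->.
Qed.

HB.instance Definition _ := Lmodule_isNormed.Build R L
  Lspace_normD Lspace_normZ Lspace_norm0_eq0.

Lemma LleE f g : Lle f g = (Lmeet f g == f).
Proof.
apply/asboolP/eqP => [fg|<-].
  by apply: Lspace_ae; apply: filterS2 fg (LmeetE f g) => x /min_l -> ->.
by apply: filterS (LmeetE f g) => x ->; rewrite ge_min lexx orbT.
Qed.

Lemma LltE f g : Llt f g = (g != f) && Lle f g.
Proof. by []. Qed.

Lemma LmeetC : commutative Lmeet.
Proof.
move=> f g; apply: Lspace_ae.
by apply: filterS2 (LmeetE f g) (LmeetE g f) => x -> ->; rewrite minC.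
Qed.

Lemma LjoinC : commutative Ljoin.
Proof.
move=> f g; apply: Lspace_ae.
by apply: filterS2 (LjoinE f g) (LjoinE g f) => x -> ->; rewrite maxC.
Qed.

Lemma LmeetA : associative Lmeet.
Proof.
move=> f g h; apply: Lspace_ae; near=> x.
rewrite (near (LmeetE f (Lmeet g h)) x) // (near (LmeetE g h) x) //.
rewrite (near (LmeetE (Lmeet f g) h) x) // (near (LmeetE f g) x) //.
by rewrite minA.
Unshelve. all: by end_near. Qed.

Lemma LjoinA : associative Ljoin.
Proof.
move=> f g h; apply: Lspace_ae; near=> x.
rewrite (near (LjoinE f (Ljoin g h)) x) // (near (LjoinE g h) x) //.
rewrite (near (LjoinE (Ljoin f g) h) x) // (near (LjoinE f g) x) //.
by rewrite maxA.
Unshelve. all: by end_near. Qed.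

Lemma LjoinKI g f : Lmeet f (Ljoin f g) = f.
Proof.
apply: Lspace_ae.
apply: filterS2 (LmeetE f (Ljoin f g)) (LjoinE f g) => x -> ->.
by rewrite maxKx.
Qed.

Lemma LmeetKU g f : Ljoin f (Lmeet f g) = f.
Proof.
apply: Lspace_ae.
apply: filterS2 (LjoinE f (Lmeet f g)) (LmeetE f g) => x -> ->.
by rewrite minKx.
Qed.

Lemma LmeetUl : left_distributive Lmeet Ljoin.
Proof.
move=> f g h; apply: Lspace_ae; near=> x.
rewrite (near (LmeetE (Ljoin f g) h) x) // (near (LjoinE f g) x) //.
rewrite (near (LjoinE (Lmeet f h) (Lmeet g h)) x) //.
rewrite (near (LmeetE f h) x) // (near (LmeetE g h) x) //.
by rewrite min_maxl.
Unshelve. all: by end_near. Qed.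

Lemma Lmeetff : idempotent_op Lmeet.
Proof.
by move=> f; apply: Lspace_ae; apply: filterS (LmeetE f f) => x ->; rewrite minxx.
Qed.

HB.instance Definition _ := Order.isMeetJoinDistrLattice.Build ring_display L
  LleE LltE LmeetC LjoinC LmeetA LjoinA LjoinKI LmeetKU LmeetUl Lmeetff.

End Lspace_class.

Section Lspace_constants.
Context d (T : measurableType d) (R : realType).
Variables (mu : {finite_measure set T -> \bar R}) (p : R).
Variable p1 : (1 <= p%:E)%E.

Definition Lcst (c : R) : LspaceType mu p1 :=
  Lclass (Lfun_Sub p1 (Lfun_cst mu c p)).

End Lspace_constants.

Definition separable (V : topologicalType) : Prop :=
  exists2 D : set V, countable D & dense D.

(* A group topology on G: the topology tau is not required to be Hausdorff. *)
Definition group_topology (G : groupType) (tau : Topological G) : Prop :=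
  let Gt : topologicalType := Topological.Pack tau in
  continuous ((fun xy => xy.1 * xy.2)%g : Gt * Gt -> Gt) /\
  continuous ((fun x => x^-1)%g : Gt -> Gt).

Section operators.
Context (R : realType).

Definition bounded_operator (V W : normedModType R) (A : V -> W) : Prop :=
  linear A /\ exists M : R, forall f, `|A f| <= M * `|f|.

Definition strongly_continuous (Gt : topologicalType) (V : normedModType R)
    (rho : Gt -> V -> V) : Prop :=
  forall f : V, continuous (fun g => rho g f).

Definition weakly_continuous (Gt : topologicalType) (V : normedModType R)
    (rho : Gt -> V -> V) : Prop :=
  forall phi : {linear V -> R^o}, continuous phi ->
  forall f : V, continuous (fun g => phi (rho g f)).

End operators.

Section representations.
Context d (X : measurableType d) (R : realType) (mu : probability X R).

Definition lattice_automorphism (p : \bar R) (p1 : (1 <= p)%E)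
    (A : LspaceType mu p1 -> LspaceType mu p1) : Prop :=
  [/\ linear A, bijective A, Order.meet_morphism A & Order.join_morphism A].

Definition isometric_lattice_action (G : groupType) (p : R)
    (p1 : (1 <= p%:E)%E)
    (rho : G -> LspaceType mu p1 -> LspaceType mu p1) : Prop :=
  [/\ rho 1%g = id,
      forall g h, rho (g * h)%g = rho g \o rho h,
      forall g, lattice_automorphism (rho g),
      forall g f, `|rho g f| = `|f|
    & forall g c, rho g (Lcst mu p1 c) = Lcst mu p1 c].

(* All the spaces LspaceType mu p1 are subtypes of the type of classes of
   measurable functions modulo a.e. equality, so elements of different L^p
   spaces are compared there. *)
Definition agree_on_Linfty (p q : R) (p1 : (1 <= p%:E)%E) (q1 : (1 <= q%:E)%E)
    (A : LspaceType mu p1 -> LspaceType mu p1)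
    (B : LspaceType mu q1 -> LspaceType mu q1) : Prop :=
  forall (f : LspaceType mu p1) (h : LspaceType mu q1),
    (f : X -> R) \in Lfun mu +oo%E ->
    f = h :> {mfun_ mu, X >-> measurableTypeR R} ->
    A f = B h :> {mfun_ mu, X >-> measurableTypeR R}.

Definition acts_naturally (G : groupType) (p0 : R) (p01 : (1 <= p0%:E)%E)
    (rho0 : G -> LspaceType mu p01 -> LspaceType mu p01)
    (rho : forall (p : R) (p1 : (1 <= p%:E)%E),
      G -> LspaceType mu p1 -> LspaceType mu p1) : Prop :=
  (forall g (f : LspaceType mu p01), (f : X -> R) \in Lfun mu +oo%E ->
     (rho0 g f : X -> R) \in Lfun mu +oo%E) /\
  (forall p (p1 : (1 <= p%:E)%E) g,
     unique (fun A => bounded_operator A /\ agree_on_Linfty (rho0 g) A)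
       (rho p p1 g)).

End representations.

(* Main.v *)
Require Import Defs.
From HB Require Import structures.
From mathcomp Require Import all_boot all_order all_algebra.
From mathcomp Require Import all_classical all_reals all_analysis.
From mathcomp Require Import ess_sup_inf measurable_realfun.
From mathcomp Require Import ring lra.
Set Implicit Arguments.
Unset Strict Implicit.
Unset Printing Implicit Defensive.
Import Order.TTheory GRing.Theory Num.Def Num.Theory.
Import numFieldNormedType.Exports.
Local Open Scope classical_set_scope.
Local Open Scope ring_scope.

(** Let T be one of the given operators on L^{p0}. Everything rests on extending
    T to a linear lattice operator S on all a.e. classes of measurable functions
    that preserves distributions. Such an S preserves every L^q-norm, so its
    restrictions to the spaces L^q are the required representations.

    T is multiplicative on bounded functions: f^2 is the supremum of the affine
    functions 2cf - c^2 over rational c, so positivity and T1 = 1 give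
    (Tf)^2 <= T(f^2) ([on_bounded_sqr_ge]); the same inequality for the inverse
    of T gives equality, and polarization gives T(fg) = Tf Tg ([on_boundedM]).
    T preserves the measure of {f > 0}: its indicator is the increasing limit of
    the ramps min(1, n f^+), lattice polynomials in f and 1, with which T commutes
    and whose norms T preserves ([mu_on_bounded_gt0]).

    Every measurable f is a quotient h / k of the bounded functions
    h = f / (1 + |f|) and k = 1 / (1 + |f|) > 0. Put Sf = Th / Tk. By
    multiplicativity any other representation f = u / v with bounded u and v > 0
    gives the same value ([on_measurable_frac]), so linearity, compatibility with
    the lattice operations and the group law follow by computing with common
    denominators. Also {Sf > c} = {T(h - ck) > 0} has the measure of
    {h - ck > 0} = {f > c}: f and Sf have the same distribution
    ([mu_on_measurable_gt]). No limit is taken in the construction of S.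

    The truncations of f in L^q to [-n, n] converge to f, so bounded functions
    are dense; this gives uniqueness of the extension. On a set of functions
    uniformly bounded by M all the L^q topologies agree, because
    |h|^q <= a^q + M^q (|h| / a)^p for every a > 0 ([bounded_moment_small]).
    Hence truncating a countable dense subset of L^p produces one of L^q
    ([separable_transfer]).

    Finally, weak continuity on a single L^p implies strong continuity on every
    L^q ([weakly_continuous_strongly]). By density only a bounded f matters. With
    S_g the extension for g, the pairing with the bounded function S_{g0} f is a
    continuous functional on L^p, so <S_g f, S_{g0} f> tends to
    <S_{g0} f, S_{g0} f> = ||f||_2^2. Since ||S_g f||_2 = ||f||_2, the
    expansion of the square shows that S_g f tends to S_{g0} f in L^2, hence in
    every L^q. *)

(** * Absolute moments and essentially bounded functions *)

Section moments.
Context d (X : measurableType d) (R : realType) (mu : probability X R).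
Implicit Types (f g h : X -> R) (p q : R).

(** The p-th power of the L^p-norm. It is defined for all functions, which lets
    different exponents be compared on functions rather than on classes. *)
Definition moment p f : \bar R := (\int[mu]_x (`|f x| `^ p)%:E)%E.

Lemma measurable_abs_powR p f : measurable_fun setT f ->
  measurable_fun setT (fun x => `|f x| `^ p).
Proof.
move=> mf; apply: (measurableT_comp (measurable_powR _)) => //.
exact: measurableT_comp.
Qed.

Lemma measurable_abs_powRe p f : measurable_fun setT f ->
  measurable_fun setT (fun x => (`|f x| `^ p)%:E).
Proof. by move=> mf; apply/measurable_EFinP; exact: measurable_abs_powR. Qed.

Lemma moment_ge0 p f : (0 <= moment p f)%E.
Proof. by apply: integral_ge0 => x _; rewrite lee_fin powR_ge0. Qed.

Lemma le_moment p f g : 0 <= p -> measurable_fun setT f ->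
  measurable_fun setT g -> (\forall x \ae mu, `|f x| <= `|g x|) ->
  (moment p f <= moment p g)%E.
Proof.
move=> p0 mf mg fg; rewrite /moment; apply: ae_ge0_le_integral => //=.
- exact: measurable_abs_powRe.
- exact: measurable_abs_powRe.
- by apply: filterS fg => x fg _; rewrite lee_fin ge0_ler_powR//.
Qed.

Lemma eq_moment p f g : measurable_fun setT f -> measurable_fun setT g ->
  (\forall x \ae mu, f x = g x) -> moment p f = moment p g.
Proof.
move=> mf mg fg; apply: ae_eq_integral => //; try exact: measurable_abs_powRe.
by apply: filterS fg => x ->.
Qed.

Lemma Lnorm_moment p f : p != 0 ->
  ('N[mu]_p%:E[EFin \o f] `^ p = moment p f)%E.
Proof. by move=> p0; rewrite poweR_Lnorm. Qed.

Lemma mem_LfunP p f : 1 <= p ->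
  f \in Lfun mu p%:E <-> measurable_fun setT f /\ (moment p f < +oo)%E.
Proof.
move=> p1; have p0 : p != 0 by rewrite gt_eqF// (lt_le_trans _ p1).
rewrite -(Lnorm_moment _ p0); split.
  move=> /[!inE] /andP[/[!inE]/= mf ff]; split=> //; exact: poweR_lty.
move=> [mf ff]; rewrite inE; apply/andP; split; rewrite inE//=.
exact: (lty_poweRy p0).
Qed.

Definition ae_bounded f :=
  measurable_fun setT f /\ exists M, \forall x \ae mu, `|f x| <= M.

Lemma mem_LfunyP f : f \in Lfun mu +oo%E <-> ae_bounded f.
Proof.
have mu0 : (0 < mu setT)%E by rewrite probability_setT.
split.
  move=> /[!inE] /andP[/[!inE]/= mf]; rewrite /finite_norm unlock /Lnorm mu0.
  by move=> /ess_supr_bounded; split.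
move=> [mf [M fM]]; rewrite inE; apply/andP; split; rewrite inE//=.
rewrite /finite_norm unlock /Lnorm mu0.
apply: (@le_lt_trans _ _ M%:E); last exact: ltry.
by apply/ess_supP; apply: filterS fM => x; rewrite lee_fin.
Qed.

Lemma moment_cst p c : 0 <= p -> moment p (cst c) = (`|c| `^ p)%:E.
Proof.
move=> p0; rewrite /moment/= integral_cst//.
by rewrite [X in (_ * X)%E](_ : _ = 1%E) ?mule1//; exact: probability_setT.
Qed.

Lemma ae_bounded_Lfun p f : 1 <= p -> ae_bounded f -> f \in Lfun mu p%:E.
Proof.
move=> p1 [mf [M fM]]; apply/(mem_LfunP _ p1); split=> //.
have p0 : 0 <= p by rewrite (le_trans _ p1).
apply: (@le_lt_trans _ _ (moment p (cst M))); last by rewrite moment_cst// ltry.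
apply: le_moment => //.
by apply: filterS fM => x /le_trans; apply; rewrite ler_norm.
Qed.

End moments.

Section ae_bounded_theory.
Context d (X : measurableType d) (R : realType) (mu : probability X R).
Implicit Types (f g h : X -> R) (p q : R).
Notation bd := (ae_bounded mu).

Lemma ae_bounded_cst c : bd (cst c).
Proof. by split=> //; exists `|c|; apply: nearW => x. Qed.

Lemma ae_boundedD f g : bd f -> bd g -> bd (fun x => f x + g x).
Proof.
move=> [mf [M fM]] [mg [N gN]]; split; first exact: measurable_funD.
exists (M + N); apply: filterS2 fM gN => x fM gN.
by rewrite (le_trans (ler_normD _ _))// lerD.
Qed.

Lemma ae_boundedM f g : bd f -> bd g -> bd (fun x => f x * g x).
Proof.
move=> [mf [M fM]] [mg [N gN]]; split; first exact: measurable_funM.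
exists (M * N); apply: filterS2 fM gN => x fM gN.
by rewrite normrM ler_pM.
Qed.

Lemma ae_boundedZ c f : bd f -> bd (fun x => c * f x).
Proof. by move=> bf; apply: ae_boundedM bf; exact: ae_bounded_cst. Qed.

Lemma ae_boundedN f : bd f -> bd (fun x => - f x).
Proof.
by move=> /(ae_boundedZ (-1)); under eq_fun do rewrite mulN1r.
Qed.

Lemma ae_boundedB f g : bd f -> bd g -> bd (fun x => f x - g x).
Proof. by move=> bf /ae_boundedN bg; exact: ae_boundedD. Qed.

Lemma ae_bounded_max f g : bd f -> bd g -> bd (fun x => maxr (f x) (g x)).
Proof.
move=> [mf [M fM]] [mg [N gN]]; split; first exact: measurable_maxr.
exists (maxr M N); apply: filterS2 fM gN => x fM gN.
by rewrite le_max /maxr; case: ifP => _; rewrite ?fM ?gN ?orbT.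
Qed.

Lemma ae_bounded_min f g : bd f -> bd g -> bd (fun x => minr (f x) (g x)).
Proof.
move=> [mf [M fM]] [mg [N gN]]; split; first exact: measurable_minr.
exists (maxr M N); apply: filterS2 fM gN => x fM gN.
by rewrite le_max /minr; case: ifP => _; rewrite ?fM ?gN ?orbT.
Qed.

End ae_bounded_theory.

(** * Functions as elements of the spaces L^p *)

Section Lspace_functions.
Context d (X : measurableType d) (R : realType) (mu : probability X R).
Implicit Types (f g h : X -> R) (p q : R).
Notation bd := (ae_bounded mu).

Section fixed_exponent.
Variables (p : R) (p1 : (1 <= p%:E)%E).
Local Notation L := (LspaceType mu p1).
Implicit Types F G : L.

(** Made total by the default value 0, so that it can be applied to a function
    before membership in L^p has been established. *)
Definition Lof f : L :=
  if pselect (f \in Lfun mu p%:E) is left fp then Lclass (Lfun_Sub p1 fp)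
  else 0.

Let p1r : 1 <= p. Proof. by rewrite -lee_fin. Qed.

Lemma LofE f : f \in Lfun mu p%:E -> \forall x \ae mu, Lof f x = f x.
Proof. by rewrite /Lof; case: pselect => // fp _; exact: Lclass_ae. Qed.

Lemma bd_LofE f : bd f -> \forall x \ae mu, Lof f x = f x.
Proof. by move=> bf; apply/LofE/ae_bounded_Lfun. Qed.

Lemma Lof_rep F : Lof F = F.
Proof. by apply: Lspace_ae; apply: LofE; exact: Lspace_Lfun. Qed.

Lemma Lof_eq f F : f \in Lfun mu p%:E -> (\forall x \ae mu, f x = F x) ->
  Lof f = F.
Proof.
by move=> /LofE ff fg; apply: Lspace_ae; apply: filterS2 ff fg => x ->.
Qed.

Lemma Lspace_addE F G : \forall x \ae mu, (F + G) x = F x + G x.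
Proof. exact: LaddE. Qed.
Lemma Lspace_oppE F : \forall x \ae mu, (- F) x = - F x.
Proof. exact: LoppE. Qed.
Lemma Lspace_scaleE a F : \forall x \ae mu, (a *: F) x = a * F x.
Proof. exact: LscaleE. Qed.
Lemma Lspace_meetE F G : \forall x \ae mu, Order.meet F G x = minr (F x) (G x).
Proof. exact: LmeetE. Qed.
Lemma Lspace_joinE F G : \forall x \ae mu, Order.join F G x = maxr (F x) (G x).
Proof. exact: LjoinE. Qed.
Lemma LcstE c : \forall x \ae mu, Lcst mu p1 c x = c.
Proof. exact: Lclass_ae. Qed.
Lemma Lspace_subE F G : \forall x \ae mu, (F - G) x = F x - G x.
Proof.
by apply: filterS2 (Lspace_addE F (- G)) (Lspace_oppE G) => x -> ->.
Qed.

Lemma ae_eq_Lspace_sub F G f g :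
  (\forall x \ae mu, F x = f x) -> (\forall x \ae mu, G x = g x) ->
  \forall x \ae mu, (F - G) x = f x - g x.
Proof.
move=> Ff Gg; apply: filterS3 (Lspace_subE F G) Ff Gg => x e1 e2 e3.
exact: etrans e1 (congr2 (fun a b : R => a - b) e2 e3).
Qed.

Lemma Lspace_norm_moment F : (`|F| `^ p)%:E = moment mu p F.
Proof.
have p0 : p != 0 by rewrite gt_eqF// (lt_le_trans _ p1r).
rewrite -(Lnorm_moment mu F p0) -poweR_EFin; congr poweR.
exact: (finite_norm_fine (Lrep F)).
Qed.

End fixed_exponent.

Lemma Lspace_mfunP p q (p1 : (1 <= p%:E)%E) (q1 : (1 <= q%:E)%E)
  (F : LspaceType mu p1) (G : LspaceType mu q1) :
  F = G :> {mfun_ mu, X >-> measurableTypeR R} <->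
  \forall x \ae mu, F x = G x.
Proof.
split=> [fg|fg]; first by apply: nearW => x; congr aqEqMfun_to_fun.
rewrite -[LHS]reprK -[RHS]reprK; apply/eqmodP/asboolP.
by apply: filterS fg.
Qed.

End Lspace_functions.

(** * Truncation and uniformly bounded functions *)

Section bounded_moments.
Context d (X : measurableType d) (R : realType) (mu : probability X R).
Implicit Types (f g h : X -> R) (p q e M c : R).
Notation bd := (ae_bounded mu).

(** On uniformly bounded functions smallness in L^q implies smallness in L^p,
    whatever the order of p and q: where |h| <= del, |h|^p is at most del^p, and
    elsewhere |h|^p <= M^p <= (M^p / del^q) |h|^q. *)
Lemma bounded_moment_small p q M e : 0 < p -> 0 < q -> 0 < e ->
  exists2 eta, 0 < eta & forall h, measurable_fun setT h ->
    (\forall x \ae mu, `|h x| <= M) -> (moment mu q h < eta%:E)%E ->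
    (moment mu p h < e%:E)%E.
Proof.
move=> p0 q0 e0.
have e20 : 0 < e / 2 by rewrite divr_gt0.
(* del is chosen so that the part where |h| <= del contributes at most e / 2. *)
pose del := (e / 2) `^ p^-1.
have del0 : 0 < del by rewrite powR_gt0.
have delp : del `^ p = e / 2.
  by rewrite -powRrM mulVf ?gt_eqF// powRr1// ltW.
pose C := M `^ p / del `^ q.
have C0 : 0 <= C by rewrite divr_ge0// powR_ge0.
exists ((e / 2) / (C + 1)); first by rewrite divr_gt0// ltr_wpDl.
move=> h mh hM mom.
have mq : measurable_fun setT (fun x => C%:E * (`|h x| `^ q)%:E)%E.
  by apply: measurable_funeM; exact: measurable_abs_powRe.
have Ch0 x : (0 <= C%:E * (`|h x| `^ q)%:E)%E.
  by rewrite -EFinM lee_fin mulr_ge0// powR_ge0.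
apply: (@le_lt_trans _ _ ((e / 2)%:E + C%:E * moment mu q h)%E).
  apply: (@le_trans _ _
    (\int[mu]_x (cst (e / 2)%:E x + C%:E * (`|h x| `^ q)%:E))%E).
    apply: ae_ge0_le_integral => //=.
    - exact: measurable_abs_powRe.
    - by move=> x _; rewrite adde_ge0// lee_fin ltW.
    - exact: emeasurable_funD.
    - apply: filterS hM => x hM _; rewrite -EFinM -EFinD lee_fin.
      have [hd|/ltW dh] := leP `|h x| del.
        rewrite -delp ler_wpDr//; first by rewrite mulr_ge0// powR_ge0.
        by rewrite ge0_ler_powR// ?nnegrE// ltW.
      rewrite ler_wpDl//; first exact: ltW.
      apply: (@le_trans _ _ (M `^ p)).
        by rewrite ge0_ler_powR ?nnegrE// ?(le_trans _ hM)// ltW.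
      rewrite /C -mulrA ler_peMr ?powR_ge0// mulrC ler_pdivlMr ?powR_gt0// mul1r.
      by rewrite ge0_ler_powR ?nnegrE// ltW.
  rewrite ge0_integralD//=; last by move=> x _; rewrite lee_fin ltW.
  rewrite integral_cst// (_ : (_ * _)%E = (e / 2)%:E); last first.
    by rewrite -[RHS]mule1; congr (_ * _)%E; exact: probability_setT.
  by rewrite ge0_integralZl_EFin//; exact: measurable_abs_powRe.
have mf : moment mu q h \is a fin_num.
  by rewrite ge0_fin_numE ?moment_ge0// (lt_trans mom)// ltry.
rewrite -(fineK mf) -EFinM -EFinD lte_fin.
move: mom; rewrite -(fineK mf) lte_fin ltr_pdivlMr ?ltr_wpDl//.
have := moment_ge0 mu q h; rewrite -(fineK mf) lee_fin.
lra.
Qed.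

Definition clip (c : R) f x : R := maxr (- c) (minr c (f x)).

Lemma measurable_clip c f : measurable_fun setT f ->
  measurable_fun setT (clip c f).
Proof. by move=> mf; apply: measurable_maxr => //; exact: measurable_minr. Qed.

Lemma clip_le c f x : 0 <= c -> `|clip c f x| <= c.
Proof.
move=> c0; rewrite /clip ler_norml le_max lexx/= ge_max ge_min lexx/= andbT.
lra.
Qed.

Lemma clip_id c f x : `|f x| <= c -> clip c f x = f x.
Proof.
by rewrite ler_norml /clip => /andP[cf fc]; rewrite (min_r fc) max_r.
Qed.

Lemma clip_lip c f g x : 0 <= c -> `|clip c f x - clip c g x| <= `|f x - g x|.
Proof.
move=> c0; rewrite /clip /minr; have [fg|fg] := ger0P (f x - g x);
  case: (ltP c (f x)) => ?; case: (ltP c (g x)) => ?; rewrite /maxr;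
  do 2?(case: ifP => [|/negbT]; rewrite -?leNgt => ?);
  rewrite ler_norml; apply/andP; split; lra.
Qed.

Lemma clip_dist c f x : 0 <= c -> `|f x - clip c f x| <= `|f x|.
Proof.
move=> c0; rewrite /clip /minr; have [fg|fg] := ger0P (f x);
  case: (ltP c (f x)) => ?; rewrite /maxr;
  case: ifP => [|/negbT]; rewrite -?leNgt => ?;
  rewrite ler_norml; apply/andP; split; lra.
Qed.

Lemma ae_bounded_clip c f : 0 <= c -> measurable_fun setT f -> bd (clip c f).
Proof.
move=> c0 mf; split; first exact: measurable_clip.
by exists c; apply: nearW => x; exact: clip_le.
Qed.

(** Dominated convergence: the error is dominated by |f|^p and vanishes at each
    point once n exceeds |f x|. *)
Lemma clip_approx p f e : 1 <= p -> f \in Lfun mu p%:E -> 0 < e ->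
  exists n : nat, (moment mu p (fun x => f x - clip n%:R f x)%R < e%:E)%E.
Proof.
move=> p1 fp e0; have p0 : 0 < p by rewrite (lt_le_trans _ p1).
have [mf _] := (mem_LfunP mu f p1).1 fp.
pose F_ n x := (`|f x - clip n%:R f x| `^ p)%:E.
have [] := @dominated_convergence _ _ _ mu setT measurableT F_ (cst 0%E)
  (fun x => (`|f x| `^ p)%:E).
- move=> n; apply: measurable_abs_powRe.
  by apply: measurable_funB => //; exact: measurable_clip.
- exact: measurable_cst.
- apply: aeW => x _; apply: cvg_near_cst.
  near=> n; rewrite /F_ clip_id ?subrr ?normr0 ?powR0 ?gt_eqF//.
  by near: n; exact: nbhs_infty_ger.
- exact: Lfun_integrable.
- apply: aeW => x n _; rewrite /F_ gee0_abs ?lee_fin ?powR_ge0//.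
  by rewrite ge0_ler_powR ?nnegrE// ?clip_dist// ltW.
move=> _ _; rewrite integral0 => cv.
have /cv : nbhs (0 : \bar R)%E [set y | (y < e%:E)%E].
  by apply: open_ereal_lt'; rewrite lte_fin.
by case=> n _ /(_ n (leqnn n)) ?; exists n.
Unshelve. all: by end_near. Qed.

End bounded_moments.

(** * Distributions and moments *)

Section equimeasurability.
Context d (X : measurableType d) (R : realType) (mu : probability X R).
Implicit Types (f g h : X -> R) (p q e M c : R).

Lemma ae_forall_nat (P : nat -> X -> Prop) :
  (forall n, \forall x \ae mu, P n x) -> \forall x \ae mu, forall n, P n x.
Proof.
move=> aeP; have : mu.-negligible (\bigcup_n ~` [set x | P n x]).
  by apply: negligible_bigcup => n; exact: aeP.
by apply: negligibleS => x /= /existsNP[n nP]; exists n.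
Qed.

(** A lattice expression in f and 1 approximating the indicator of {f > 0};
    unital lattice homomorphisms commute with it. *)
Definition ramp (n : nat) f x : R := minr 1 (n%:R * maxr 0 (f x)).

Lemma measurable_ramp n f : measurable_fun setT f ->
  measurable_fun setT (ramp n f).
Proof.
move=> mf; apply: measurable_minr => //.
by apply: measurable_funM => //; exact: measurable_maxr.
Qed.

Lemma ramp_ge0 n f x : 0 <= ramp n f x.
Proof. by rewrite /ramp le_min ler01 mulr_ge0// le_max lexx. Qed.

Lemma ramp_le1 n f x : ramp n f x <= 1.
Proof. by rewrite /ramp ge_min lexx. Qed.

Lemma ae_bounded_ramp n f : measurable_fun setT f -> ae_bounded mu (ramp n f).
Proof.
move=> mf; split; first exact: measurable_ramp.
by exists 1; apply: nearW => x; rewrite ger0_norm ?ramp_ge0// ramp_le1.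
Qed.

Lemma measurable_gt0 f : measurable_fun setT f -> measurable [set x | 0 < f x].
Proof.
move=> mf; rewrite (_ : [set _ | _] = setT `&` f @^-1` `]0, +oo[).
  exact: mf.
by apply/seteqP; split=> x /=; rewrite in_itv/= andbT// => -[].
Qed.

Lemma cvg_moment_ramp p f : 0 < p -> measurable_fun setT f ->
  moment mu p (ramp n f) @[n --> \oo] --> mu [set x | 0 < f x].
Proof.
move=> p0 mf; pose A := [set x | 0 < f x].
have mA : measurable A by exact: measurable_gt0.
have [] := @dominated_convergence _ _ _ mu setT measurableT
  (fun n x => (`|ramp n f x| `^ p)%:E) (EFin \o \1_A) (cst 1%E).
- by move=> n; apply: measurable_abs_powRe; exact: measurable_ramp.
- by apply/measurable_EFinP; exact: measurable_indic.
- apply: aeW => x _; apply: cvg_near_cst; rewrite /= indicE.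
  have [fx|fx] := ltP 0 (f x).
    near=> n; rewrite mem_set// /ramp (max_r (ltW fx)) min_l ?normr1 ?powR1//.
    by rewrite -ler_pdivrMr//; near: n; exact: nbhs_infty_ger.
  near=> n; rewrite memNset/=; last by apply/negP; rewrite -leNgt.
  by rewrite /ramp (max_l fx) mulr0 min_r// normr0 powR0// gt_eqF.
- by apply: finite_measure_integrable_cst.
- apply: aeW => x n _; rewrite gee0_abs ?lee_fin ?powR_ge0//.
  have <- : 1 `^ p = 1 :> R by rewrite powR1.
  by rewrite ge0_ler_powR ?nnegrE ?(ltW p0)// ger0_norm ?ramp_ge0// ramp_le1.
by move=> _ _; rewrite integral_indic// setIT.
Unshelve. all: by end_near. Qed.

Lemma ae_eq_measure (A B : set X) : measurable A -> measurable B ->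
  (\forall x \ae mu, A x <-> B x) -> mu A = mu B.
Proof.
move=> mA mB AB; rewrite -[A]setIT -[B]setIT -!integral_indic//.
apply: ae_eq_integral => //; try exact/measurable_EFinP/measurable_indic.
by apply: filterS AB => x AB _ /=; rewrite !indicE (_ : (x \in A) = (x \in B))//;
  apply/idP/idP; rewrite !inE => /AB.
Qed.

Lemma ae_gt0P f : measurable_fun setT f ->
  mu [set x | 0 < f x] = 1%E <-> \forall x \ae mu, 0 < f x.
Proof.
move=> mf; have mA := measurable_gt0 mf.
have AC := probability_setC mu mA; split=> [A1|f0].
  exists (~` [set x | 0 < f x]); split => //; first exact: measurableC.
  by rewrite AC A1 subee.
have nA : mu.-negligible (~` [set x | 0 < f x]) by exact: f0.
have [AC0 _] := negligibleP mu (measurableC mA).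
have := probability_setC mu (measurableC mA).
by rewrite setCK (AC0 nA) sube0.
Qed.

(** The layer-cake formula, applied to |f|^p. *)
Lemma moment_tail p f : 0 < p -> measurable_fun setT f ->
  moment mu p f = (\int[@lebesgue_measure R]_(r in `[0%R, +oo[)
      mu [set x | (((r : R) `^ p^-1)%R < `|f x|%R)%R])%E.
Proof.
move=> p0 mf.
have mY : measurable_fun setT (fun x => `|f x| `^ p) by exact: measurable_abs_powR.
pose Z : {RV mu >-> R} := mfun_Sub (mem_set mY).
have := @ge0_expectation_ccdf _ _ _ mu Z (fun x => powR_ge0 _ _).
rewrite expectation_def => EZ.
transitivity (\int[mu]_x (Z x)%:E)%E; first by [].
rewrite EZ; apply: eq_integral => r.
rewrite inE/= in_itv/= andbT => r0.
rewrite /ccdf /distribution /pushforward; congr (mu _).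
apply/seteqP; split=> x /=; rewrite in_itv/= andbT => H.
- rewrite -[ltRHS](powRr1 (normr_ge0 _)) -(mulfV (lt0r_neq0 p0)) powRrM.
  by rewrite gt0_ltr_powR ?nnegrE ?powR_ge0 ?invr_gt0.
- rewrite -[ltLHS](powRr1 r0) -(mulVf (lt0r_neq0 p0)) powRrM.
  by rewrite gt0_ltr_powR ?nnegrE ?powR_ge0.
Qed.


Lemma equimeasurable_moment p f g : 0 < p -> measurable_fun setT f ->
  measurable_fun setT g ->
  (forall c, mu [set x | c < `|f x|] = mu [set x | c < `|g x|]) ->
  moment mu p f = moment mu p g.
Proof.
move=> p0 mf mg fg; rewrite !moment_tail//.
by apply: eq_integral => r _; exact: fg.
Qed.

End equimeasurability.

(** * Unital lattice isometries on bounded functions *)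

Section Lof_morphisms.
Context d (X : measurableType d) (R : realType) (mu : probability X R).
Variables (p : R) (p1 : (1 <= p%:E)%E).
Local Notation L := (LspaceType mu p1).
Local Notation Lof := (Lof mu p1).
Implicit Types (f g h : X -> R) (F G : L) (a c : R).

Lemma eq_Lof f g : f \in Lfun mu p%:E -> g \in Lfun mu p%:E ->
  (\forall x \ae mu, f x = g x) -> Lof f = Lof g.
Proof.
move=> fL gL fg; apply: Lof_eq => //.
by apply: filterS2 fg (LofE p1 gL) => x -> ->.
Qed.

Let pr1 : 1 <= p. Proof. by rewrite -lee_fin. Qed.

Lemma Lof_cst c : Lof (cst c) = Lcst mu p1 c.
Proof.
apply: Lof_eq; first exact: Lfun_cst.
by apply: filterS (LcstE mu p1 c) => x ->.
Qed.

Let addL f g : f \in Lfun mu p%:E -> g \in Lfun mu p%:E ->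
  (fun x => f x + g x) \in Lfun mu p%:E.
Proof. by move=> fL gL; have := Lfun_addr_closed mu p1; case=> _; apply. Qed.

Let scaleL a f : f \in Lfun mu p%:E -> (fun x => a * f x) \in Lfun mu p%:E.
Proof.
move=> fL; rewrite (_ : (fun x => _) = a *: Lfun_Sub p1 fL :> (X -> R))//.
exact: LfunP.
Qed.

Lemma LofD f g : f \in Lfun mu p%:E -> g \in Lfun mu p%:E ->
  Lof (fun x => f x + g x) = Lof f + Lof g.
Proof.
move=> fL gL; apply: Lof_eq; first exact: addL.
by apply: filterS3 (LofE p1 fL) (LofE p1 gL) (Lspace_addE (Lof f) (Lof g)) =>
  x -> -> ->.
Qed.

Lemma LofZ a f : f \in Lfun mu p%:E -> Lof (fun x => a * f x) = a *: Lof f.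
Proof.
move=> fL; apply: Lof_eq; first exact: scaleL.
by apply: filterS2 (LofE p1 fL) (Lspace_scaleE a (Lof f)) => x -> ->.
Qed.

Lemma Lof_max f g : f \in Lfun mu p%:E -> g \in Lfun mu p%:E ->
  Lof (fun x => maxr (f x) (g x)) = Order.join (Lof f) (Lof g).
Proof.
move=> fL gL; apply: Lof_eq.
  exact: (Lfun_max (Lfun_Sub p1 fL) (Lfun_Sub p1 gL)).
by apply: filterS3 (LofE p1 fL) (LofE p1 gL) (Lspace_joinE (Lof f) (Lof g)) =>
  x -> -> ->.
Qed.

Lemma Lof_min f g : f \in Lfun mu p%:E -> g \in Lfun mu p%:E ->
  Lof (fun x => minr (f x) (g x)) = Order.meet (Lof f) (Lof g).
Proof.
move=> fL gL; apply: Lof_eq.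
  exact: (Lfun_min (Lfun_Sub p1 fL) (Lfun_Sub p1 gL)).
by apply: filterS3 (LofE p1 fL) (LofE p1 gL) (Lspace_meetE (Lof f) (Lof g)) =>
  x -> -> ->.
Qed.

End Lof_morphisms.

Section bounded_part.
Context d (X : measurableType d) (R : realType) (mu : probability X R).
Variables (p : R) (p1 : (1 <= p%:E)%E).
Local Notation L := (LspaceType mu p1).
Local Notation Lof := (Lof mu p1).
Local Notation bd := (ae_bounded mu).
Implicit Types (f g h : X -> R) (F G : L) (a c M : R) (T : L -> L).

Definition unital_lattice_isometry T := [/\ linear T,
  Order.meet_morphism T, Order.join_morphism T,
  forall F, `|T F| = `|F| & forall c, T (Lcst mu p1 c) = Lcst mu p1 c].

Let pr1 : 1 <= p. Proof. by rewrite -lee_fin. Qed.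
Let p0 : 0 < p. Proof. by rewrite (lt_le_trans _ pr1). Qed.
Let bdL f : bd f -> f \in Lfun mu p%:E. Proof. exact: ae_bounded_Lfun. Qed.

(** A representative of the image under T of the class of f. Working with
    functions makes products, which leave L^p, available. *)
Definition on_bounded T f : X -> R := T (Lof f).

Lemma measurable_on_bounded T f : measurable_fun setT (on_bounded T f).
Proof. exact: measurable_Lspace. Qed.

Lemma eq_on_bounded T f g : bd f -> bd g -> (\forall x \ae mu, f x = g x) ->
  on_bounded T f = on_bounded T g.
Proof.
by move=> bf bg fg; rewrite /on_bounded (eq_Lof p1 (bdL bf) (bdL bg)).
Qed.

Variable T : L -> L.
Hypothesis uT : unital_lattice_isometry T.
Local Notation t := (on_bounded T).

Lemma on_bounded_cst c : \forall x \ae mu, t (cst c) x = c.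
Proof. by case: uT => _ _ _ _ Tc; rewrite /t Lof_cst Tc; exact: LcstE. Qed.

Let TD F G : T (F + G) = T F + T G.
Proof. by case: uT => /(_ 1 F G); rewrite !scale1r. Qed.
Let T0 : T 0 = 0.
Proof.
by have := TD 0 0; rewrite addr0 => /(congr1 (+%R^~ (- T 0)));
  rewrite addrK subrr.
Qed.
Let TZ a F : T (a *: F) = a *: T F.
Proof. by case: uT => /(_ a F 0); rewrite T0 !addr0. Qed.

Lemma on_boundedD f g : bd f -> bd g ->
  \forall x \ae mu, t (fun x => f x + g x) x = t f x + t g x.
Proof.
by move=> bf bg; rewrite /t (LofD p1 (bdL bf) (bdL bg)) TD; exact: Lspace_addE.
Qed.

Lemma on_boundedZ a f : bd f ->
  \forall x \ae mu, t (fun x => a * f x) x = a * t f x.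
Proof.
by move=> bf; rewrite /t (LofZ p1 a (bdL bf)) TZ; exact: Lspace_scaleE.
Qed.

Lemma on_bounded_max f g : bd f -> bd g ->
  \forall x \ae mu, t (fun x => maxr (f x) (g x)) x = maxr (t f x) (t g x).
Proof.
case: uT => _ _ Tj _ _ bf bg.
by rewrite /t (Lof_max p1 (bdL bf) (bdL bg)) Tj; exact: Lspace_joinE.
Qed.

Lemma on_bounded_min f g : bd f -> bd g ->
  \forall x \ae mu, t (fun x => minr (f x) (g x)) x = minr (t f x) (t g x).
Proof.
case: uT => _ Tm _ _ _ bf bg.
by rewrite /t (Lof_min p1 (bdL bf) (bdL bg)) Tm; exact: Lspace_meetE.
Qed.

Lemma on_boundedB f g : bd f -> bd g ->
  \forall x \ae mu, t (fun x => f x - g x) x = t f x - t g x.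
Proof.
move=> bf bg; have bNg := ae_boundedZ (-1) bg.
rewrite (@eq_on_bounded _ _ (fun x => f x + -1 * g x)).
- apply: filterS2 (on_boundedD bf bNg) (on_boundedZ (-1) bg) => x -> ->.
  by rewrite mulN1r.
- exact: ae_boundedB.
- exact: ae_boundedD.
- by apply: nearW => x; rewrite mulN1r.
Qed.

Lemma on_bounded_le f g : bd f -> bd g -> (\forall x \ae mu, f x <= g x) ->
  \forall x \ae mu, t f x <= t g x.
Proof.
move=> bf bg fg; have := on_bounded_max bf bg.
rewrite (@eq_on_bounded _ _ g) //; first last.
- by apply: filterS fg => x /max_r.
- exact: ae_bounded_max.
by apply: filterS => x ->; rewrite le_max lexx.
Qed.

(** Positivity of T applied to -M <= f <= M. *)
Lemma on_bounded_norm_le f M : bd f -> (\forall x \ae mu, `|f x| <= M) ->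
  \forall x \ae mu, `|t f x| <= M.
Proof.
move=> bf fM; have bM c : bd (cst c) := ae_bounded_cst mu c.
have h1 : \forall x \ae mu, t f x <= t (cst M) x.
  apply: on_bounded_le => //.
  by apply: filterS fM => x; rewrite ler_norml => /andP[].
have h2 : \forall x \ae mu, t (cst (- M)) x <= t f x.
  apply: on_bounded_le => //.
  by apply: filterS fM => x; rewrite ler_norml => /andP[].
near=> x; rewrite ler_norml; apply/andP; split.
  by rewrite -(near (on_bounded_cst (- M)) x)// (near h2 x).
by rewrite -(near (on_bounded_cst M) x)// (near h1 x).
Unshelve. all: by end_near. Qed.

Lemma ae_bounded_on_bounded f : bd f -> bd (t f).
Proof.
move=> bf; split; first exact: measurable_on_bounded.
by have [_ [M fM]] := bf; exists M; exact: on_bounded_norm_le.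
Qed.

(** Each c gives 2cf - c^2 <= f^2, hence 2c Tf - c^2 <= T(f^2) a.e.; countably
    many c suffice, and the supremum over them is (Tf)^2. *)
Lemma on_bounded_sqr_ge f : bd f ->
  \forall x \ae mu, t f x * t f x <= t (fun x => f x * f x) x.
Proof.
move=> bf; have bff := ae_boundedM bf bf.
have aff c : \forall x \ae mu, 2 * c * t f x - c * c <= t (fun x => f x * f x) x.
  have b2 := ae_boundedZ (2 * c) bf.
  have bc := ae_bounded_cst mu (c * c).
  have le : \forall x \ae mu, t (fun x => 2 * c * f x - cst (c * c) x) x
      <= t (fun x => f x * f x) x.
    apply: on_bounded_le => //; first exact: ae_boundedB.
    by apply: nearW => x /=; have := sqr_ge0 (f x - c); rewrite expr2; lra.
  have {}le : \forall x \ae mu, t (fun x => 2 * c * f x) x - t (cst (c * c)) x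
      <= t (fun x => f x * f x) x.
    by apply: filterS2 (on_boundedB b2 bc) le => x ->.
  by apply: filterS3 (on_boundedZ (2 * c) bf) (on_bounded_cst (c * c)) le => x -> ->.
have := ae_forall_nat (fun n => aff (ratr (odflt 0 (@unpickle rat n)))).
apply: filterS => x H.
have {}H (q : rat) : 2 * ratr q * t f x - ratr q * ratr q <=
  t (fun x => f x * f x) x by have := H (pickle q); rewrite pickleK.
set a := t f x in H *; set b := t _ x in H *.
rewrite leNgt; apply/negP => ba.
(* A rational within e <= 1 of a violates the bound when e <= a^2 - b. *)
pose e := minr 1 (a * a - b).
have e0 : 0 < e by rewrite /e lt_min ltr01 subr_gt0.
have /rat_in_itvoo[q] : a - e < a by rewrite ltrBlDr ltrDl.
rewrite in_itv/= => /andP[q1 q2].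
have e1 : e <= 1 by rewrite /e ge_min lexx.
have e2 : e <= a * a - b by rewrite /e ge_min lexx orbT.
have := H q; nra.
Qed.

(** T commutes with ramps and preserves their norms, whose p-th powers converge
    to the measures of the two sets. *)
Lemma mu_on_bounded_gt0 f : bd f ->
  mu [set x | 0 < t f x] = mu [set x | 0 < f x].
Proof.
move=> bf; have mf := bf.1; have mtf := measurable_on_bounded T f.
have cf := cvg_moment_ramp (mu := mu) p0 mf.
have ctf := cvg_moment_ramp (mu := mu) p0 mtf.
have E : (fun n => moment mu p (ramp n (t f))) =
         (fun n => moment mu p (ramp n f)).
  apply/funext => n.
  have bc c : bd (cst c) := ae_bounded_cst mu c.
  have b0 := ae_bounded_max (bc 0) bf.
  have bn := ae_boundedZ n%:R b0.
  have br := ae_bounded_ramp mu n mf.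
  have tr : \forall x \ae mu, t (ramp n f) x = ramp n (t f) x.
    near=> x; rewrite /ramp (near (on_bounded_min (bc 1) bn) x)//.
    rewrite (near (on_bounded_cst 1) x)// (near (on_boundedZ n%:R b0) x)//.
    rewrite (near (on_bounded_max (bc 0) bf) x)//.
    by rewrite (near (on_bounded_cst 0) x).
  transitivity (moment mu p (t (ramp n f))).
    apply: eq_moment; [exact: measurable_ramp|exact: measurable_on_bounded|].
    by apply: filterS tr => x.
  have [_ _ _ Tn _] := uT.
  rewrite /t -Lspace_norm_moment Tn Lspace_norm_moment.
  apply: eq_moment; [exact: measurable_Lspace|exact: measurable_ramp|].
  exact: bd_LofE.
rewrite E in ctf.
by rewrite -(cvg_lim (@ereal_hausdorff R) cf) (cvg_lim (@ereal_hausdorff R) ctf).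
Unshelve. all: by end_near. Qed.

End bounded_part.

(** * Multiplicativity *)

Section multiplicativity.
Context d (X : measurableType d) (R : realType) (mu : probability X R).
Variables (p : R) (p1 : (1 <= p%:E)%E).
Local Notation L := (LspaceType mu p1).
Local Notation bd := (ae_bounded mu).
Implicit Types (f g u v w : X -> R) (F G : L) (a c : R).

Variables T T' : L -> L.
Hypotheses (uT : unital_lattice_isometry T) (uT' : unital_lattice_isometry T').
Hypotheses (TK : cancel T T') (T'K : cancel T' T).
Local Notation t := (on_bounded T).
Local Notation t' := (on_bounded T').
Local Notation Lof := (Lof mu p1).

Let pr1 : 1 <= p. Proof. by rewrite -lee_fin. Qed.

Lemma on_bounded_comp (U V : L -> L) f :
  on_bounded U (on_bounded V f) = (U (V (Lof f)) : X -> R).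
Proof. by rewrite /on_bounded Lof_rep. Qed.

(** Applying the inequality for T' to Tf gives f^2 <= T'((Tf)^2); applying T
    then reverses the inequality known for T. *)
Lemma on_bounded_sqr f : bd f ->
  \forall x \ae mu, t (fun x => f x * f x) x = t f x * t f x.
Proof.
move=> bf; have bff := ae_boundedM bf bf.
have btf := ae_bounded_on_bounded uT bf; have btff := ae_boundedM btf btf.
have t'tf : \forall x \ae mu, t' (t f) x = f x.
  by rewrite on_bounded_comp TK; exact: bd_LofE.
have ge' : \forall x \ae mu, f x * f x <= t' (fun x => t f x * t f x) x.
  by apply: filterS2 t'tf (on_bounded_sqr_ge uT' btf) => x ->.
have bt' := ae_bounded_on_bounded uT' btff.
have ge := on_bounded_le uT bff bt' ge'.
have tt' : \forall x \ae mu, t (t' (fun x => t f x * t f x)) x = t f x * t f x.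
  by rewrite on_bounded_comp T'K; exact: bd_LofE.
apply: filterS3 (on_bounded_sqr_ge uT bf) ge tt' => x le1 le2 E.
by apply/eqP; rewrite eq_le le1 -E le2.
Qed.

(** Polarization of the identity for squares. *)
Lemma on_boundedM f g : bd f -> bd g ->
  \forall x \ae mu, t (fun x => f x * g x) x = t f x * t g x.
Proof.
move=> bf bg; have bs := ae_boundedD bf bg; have bd := ae_boundedB bf bg.
have bss := ae_boundedM bs bs; have bdd := ae_boundedM bd bd.
have bB := ae_boundedB bss bdd.
rewrite (@eq_on_bounded _ _ _ _ _ _ _ _
  (fun x => 4^-1 * ((f x + g x) * (f x + g x) - (f x - g x) * (f x - g x)))).
- near=> x; rewrite (near (on_boundedZ uT 4^-1 bB) x)//.
  rewrite (near (on_boundedB uT bss bdd) x)//.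
  rewrite (near (on_bounded_sqr bs) x)// (near (on_bounded_sqr bd) x)//.
  rewrite (near (on_boundedD uT bf bg) x)// (near (on_boundedB uT bf bg) x)//.
  by field.
- exact: ae_boundedM.
- exact: ae_boundedZ.
- by apply: nearW => x; field.
Unshelve. all: by end_near. Qed.

End multiplicativity.

Definition unital_lattice_automorphism d (X : measurableType d) (R : realType)
    (mu : probability X R) (p : R) (p1 : (1 <= p%:E)%E)
    (T : LspaceType mu p1 -> LspaceType mu p1) : Prop :=
  exists T', [/\ unital_lattice_isometry T, unital_lattice_isometry T',
    cancel T T' & cancel T' T].

(** * Extension to all measurable functions *)

Section fractions.
Context d (X : measurableType d) (R : realType) (mu : probability X R).
Implicit Types (f g u v w : X -> R) (a c : R).
Local Notation bd := (ae_bounded mu).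

(** The inverse is written as a real power because powers with a fixed exponent
    are measurable functions on the whole line. *)
Definition frac_den f x : R := (1 + `|f x|) `^ (-1).
Definition frac_num f x : R := f x * frac_den f x.

Lemma frac_denE f x : frac_den f x = (1 + `|f x|)^-1.
Proof. by rewrite /frac_den powR_inv1// addr_ge0. Qed.

Lemma frac_den_gt0 f x : 0 < frac_den f x.
Proof. by rewrite frac_denE invr_gt0 ltr_wpDr. Qed.

Lemma measurable_frac_den f : measurable_fun setT f ->
  measurable_fun setT (frac_den f).
Proof.
move=> mf; apply: (measurableT_comp (measurable_powR _)).
by apply: measurable_funD => //; exact: measurableT_comp.
Qed.

Lemma ae_bounded_frac_den f : measurable_fun setT f -> bd (frac_den f).
Proof.
move=> mf; split; first exact: measurable_frac_den.
exists 1; apply: nearW => x; rewrite gtr0_norm ?frac_den_gt0// frac_denE.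
by rewrite invf_le1 ?lerDl// ltr_wpDr.
Qed.

Lemma ae_bounded_frac_num f : measurable_fun setT f -> bd (frac_num f).
Proof.
move=> mf; split.
  by apply: measurable_funM => //; exact: measurable_frac_den.
exists 1; apply: nearW => x; rewrite /frac_num normrM (gtr0_norm (frac_den_gt0 _ _)).
by rewrite frac_denE ler_pdivrMr ?ltr_wpDr// mul1r lerDr.
Qed.

End fractions.

Section extension.
Context d (X : measurableType d) (R : realType) (mu : probability X R).
Variables (p : R) (p1 : (1 <= p%:E)%E).
Local Notation L := (LspaceType mu p1).
Local Notation bd := (ae_bounded mu).
Implicit Types (f g u v w : X -> R) (F G : L) (a c : R).
Local Notation mf := (measurable_fun setT).

(** The quotient of the images of the bounded numerator and denominator of f;
    the power is an inverse a.e., where the image of the denominator is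
    positive. *)
Definition on_measurable (T : L -> L) f x : R :=
  on_bounded T (frac_num f) x * (on_bounded T (frac_den f) x) `^ (-1).

Variable T : L -> L.
Hypothesis aT : unital_lattice_automorphism T.
Local Notation t := (on_bounded T).
Local Notation S := (on_measurable T).
Local Notation num := frac_num.
Local Notation den := frac_den.

Let uT : unital_lattice_isometry T. Proof. by case: aT => T' []. Qed.
Let tM u v : bd u -> bd v ->
  \forall x \ae mu, t (fun x => u x * v x) x = t u x * t v x.
Proof. by case: aT => T' [? uT' TK T'K]; exact: (on_boundedM uT uT'). Qed.

Lemma measurable_on_measurable f : mf (S f).
Proof.
apply: measurable_funM; first exact: measurable_on_bounded.
apply: (measurableT_comp (measurable_powR _)).
exact: measurable_on_bounded.
Qed.

Lemma eq_on_measurable f g : mf f -> mf g -> (\forall x \ae mu, f x = g x) ->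
  S f = S g.
Proof.
move=> mff mg fg; rewrite /on_measurable.
have E : \forall x \ae mu, den f x = den g x.
  by apply: filterS fg => x fg; rewrite /den fg.
rewrite (eq_on_bounded T (ae_bounded_frac_num mu mff) (ae_bounded_frac_num mu mg)).
  by rewrite (eq_on_bounded T (ae_bounded_frac_den mu mff) (ae_bounded_frac_den mu mg)).
by apply: filterS2 fg E => x; rewrite /num => -> ->.
Qed.

Lemma on_bounded_gt0 v : bd v -> (\forall x \ae mu, 0 < v x) ->
  \forall x \ae mu, 0 < t v x.
Proof.
move=> bv /(ae_gt0P mu bv.1) v0.
by apply/(ae_gt0P mu (measurable_on_bounded T v)); rewrite mu_on_bounded_gt0.
Qed.

(** Independence of the representation as a fraction: the relation
    num f * v = u * den f between bounded functions is preserved by T, and the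
    image of den f can then be cancelled. *)
Lemma on_measurable_frac f u v : mf f -> bd u -> bd v ->
  (\forall x \ae mu, 0 < v x) -> (\forall x \ae mu, f x * v x = u x) ->
  \forall x \ae mu, S f x * t v x = t u x.
Proof.
move=> mff bu bv v0 fvu.
have bn := ae_bounded_frac_num mu mff; have bk := ae_bounded_frac_den mu mff.
have tk0 : \forall x \ae mu, 0 < t (den f) x.
  by apply: on_bounded_gt0 => //; apply: nearW => x; exact: frac_den_gt0.
have E : t (fun x => num f x * v x) = t (fun x => u x * den f x).
  apply: (eq_on_bounded T (ae_boundedM bn bv) (ae_boundedM bu bk)).
  by apply: filterS fvu => x <-; rewrite /num mulrAC.
have M1 := tM bn bv.
have M2 := tM bu bk.
rewrite E in M1.
apply: filterS3 tk0 M1 M2 => x k0 -> e.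
rewrite /on_measurable powR_inv1 ?(ltW k0)// mulrAC e mulfK// gt_eqF//.
Qed.

(** The extension at f is identified by exhibiting one fraction u / v equal to f
    and checking that w has the fraction of the images as its value. *)
Lemma on_measurableE f u v w : mf f -> bd u -> bd v ->
  (\forall x \ae mu, 0 < v x) -> (\forall x \ae mu, f x * v x = u x) ->
  (\forall x \ae mu, w x * t v x = t u x) ->
  \forall x \ae mu, S f x = w x.
Proof.
move=> mff bu bv v0 fvu wvu.
apply: filterS3 (on_bounded_gt0 bv v0) (on_measurable_frac mff bu bv v0 fvu) wvu.
by move=> x tv0 <- /(mulIf (lt0r_neq0 tv0)).
Qed.

Lemma on_measurable_bounded f : bd f -> \forall x \ae mu, S f x = t f x.
Proof.
move=> bf; have b1 := ae_bounded_cst mu (1 : R).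
apply: (on_measurableE bf.1 bf b1); first exact: nearW.
  by apply: nearW => x; rewrite mulr1.
by apply: filterS (on_bounded_cst uT 1) => x ->; rewrite mulr1.
Qed.

Lemma on_measurable_cst c : \forall x \ae mu, S (cst c) x = c.
Proof.
apply: filterS2 (on_measurable_bounded (ae_bounded_cst mu c)) (on_bounded_cst uT c).
by move=> x -> ->.
Qed.

Section binary.
Variables (f g : X -> R) (mff : mf f) (mg : mf g).

Let bnf := ae_bounded_frac_num mu mff.
Let bng := ae_bounded_frac_num mu mg.
Let bkf := ae_bounded_frac_den mu mff.
Let bkg := ae_bounded_frac_den mu mg.
Let bfg := ae_boundedM bnf bkg.
Let bgf := ae_boundedM bng bkf.
Let bk := ae_boundedM bkf bkg.

Let k0 : \forall x \ae mu, 0 < den f x * den g x.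
Proof. by apply: nearW => x; rewrite mulr_gt0 ?frac_den_gt0. Qed.

Let Sf : \forall x \ae mu, S f x * t (den f) x = t (num f) x.
Proof.
apply: on_measurable_frac => //.
  by apply: nearW => x; exact: frac_den_gt0.
exact: nearW.
Qed.

Let Sg : \forall x \ae mu, S g x * t (den g) x = t (num g) x.
Proof.
apply: on_measurable_frac => //.
  by apply: nearW => x; exact: frac_den_gt0.
exact: nearW.
Qed.

(** Both functions brought to the common denominator den f * den g, and the
    values of the extension read off there. *)
Let common : \forall x \ae mu,
  [/\ 0 < t (fun x => den f x * den g x) x,
      t (fun x => num f x * den g x) x
        = S f x * t (fun x => den f x * den g x) x &
      t (fun x => num g x * den f x) x
        = S g x * t (fun x => den f x * den g x) x].
Proof.
near=> x; split; first by near: x; exact: on_bounded_gt0.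
  rewrite (near (tM bnf bkg) x)// (near (tM bkf bkg) x)// -(near Sf x)//.
  by rewrite mulrA.
rewrite (near (tM bng bkf) x)// (near (tM bkf bkg) x)// -(near Sg x)//.
by rewrite mulrA mulrAC.
Unshelve. all: by end_near. Qed.

Lemma on_measurableD :
  \forall x \ae mu, S (fun x => f x + g x) x = S f x + S g x.
Proof.
apply: (on_measurableE _ (ae_boundedD bfg bgf) bk k0).
- exact: measurable_funD.
- by apply: nearW => x; rewrite /num; ring.
- apply: filterS2 common (on_boundedD uT bfg bgf) => x [_ e1 e2] ->.
  by rewrite e1 e2 mulrDl.
Qed.

Lemma on_measurable_max :
  \forall x \ae mu, S (fun x => maxr (f x) (g x)) x = maxr (S f x) (S g x).
Proof.
apply: (on_measurableE _ (ae_bounded_max bfg bgf) bk k0).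
- exact: measurable_maxr.
- apply: filterS k0 => x kx0; rewrite maxr_pMl ?(ltW kx0)// /num.
  by congr maxr; ring.
- apply: filterS2 common (on_bounded_max uT bfg bgf) => x [k0' e1 e2] ->.
  by rewrite e1 e2 maxr_pMl// ltW.
Qed.

Lemma on_measurable_min :
  \forall x \ae mu, S (fun x => minr (f x) (g x)) x = minr (S f x) (S g x).
Proof.
apply: (on_measurableE _ (ae_bounded_min bfg bgf) bk k0).
- exact: measurable_minr.
- apply: filterS k0 => x kx0; rewrite minr_pMl ?(ltW kx0)// /num.
  by congr minr; ring.
- apply: filterS2 common (on_bounded_min uT bfg bgf) => x [k0' e1 e2] ->.
  by rewrite e1 e2 minr_pMl// ltW.
Qed.

Lemma on_measurableZ a : \forall x \ae mu, S (fun x => a * f x) x = a * S f x.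
Proof.
apply: (on_measurableE _ (ae_boundedZ a bnf) bkf).
- exact: measurable_funM.
- by apply: nearW => x; exact: frac_den_gt0.
- by apply: nearW => x; rewrite /num mulrA.
- by apply: filterS2 Sf (on_boundedZ uT a bnf) => x <- ->; rewrite mulrA.
Qed.

(** Both sets are positivity sets of bounded functions, T(num - c den) and
    num - c den, because the denominators are positive. *)
Lemma mu_on_measurable_gt c : mu [set x | c < S f x] = mu [set x | c < f x].
Proof.
have bc := ae_boundedB bnf (ae_boundedZ c bkf).
have gtE u : [set x | c < u x] = [set x | 0 < u x - c] :> set X.
  by apply/seteqP; split=> x /=; rewrite subr_gt0.
transitivity (mu [set x | 0 < t (fun x => num f x - c * den f x) x]).
  rewrite gtE; apply: ae_eq_measure.
  - apply: measurable_gt0; apply: measurable_funB => //.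
    exact: measurable_on_measurable.
  - exact/measurable_gt0/measurable_on_bounded.
  have den0 : \forall x \ae mu, 0 < t (den f) x.
    by apply: on_bounded_gt0 => //; apply: nearW => x; exact: frac_den_gt0.
  near=> x => /=.
  rewrite (near (on_boundedB uT bnf (ae_boundedZ c bkf)) x)//.
  rewrite (near (on_boundedZ uT c bkf) x)// -(near Sf x)// -mulrBl pmulr_lgt0//.
  by near: x.
rewrite mu_on_bounded_gt0// gtE; congr (mu _).
by apply/seteqP; split=> x /=; rewrite /num -mulrBl pmulr_lgt0// frac_den_gt0.
Unshelve. all: by end_near. Qed.

End binary.

Lemma on_measurable_norm f : mf f ->
  \forall x \ae mu, S (fun x => `|f x|) x = `|S f x|.
Proof.
move=> mff; have mNf : mf (fun x => -1 * f x) by exact: measurable_funM.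
rewrite (@eq_on_measurable _ (fun x => maxr (f x) (-1 * f x))).
- apply: filterS2 (on_measurable_max mff mNf) (on_measurableZ mff (-1)) => x -> ->.
  by rewrite mulN1r maxrN.
- exact: measurableT_comp.
- exact: measurable_maxr.
- by apply: nearW => x; rewrite mulN1r maxrN.
Qed.

Lemma moment_on_measurable q f : 0 < q -> mf f ->
  moment mu q (S f) = moment mu q f.
Proof.
move=> q0 mff; apply: equimeasurable_moment => // [|c].
  exact: measurable_on_measurable.
have mn : mf (fun x => `|f x|) by exact: measurableT_comp.
rewrite -(mu_on_measurable_gt mn); apply: ae_eq_measure.
- rewrite (_ : [set _ | _] = [set x | 0 < `|S f x| - c]).
    apply/measurable_gt0/measurable_funB => //; apply: measurableT_comp => //.
    exact: measurable_on_measurable.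
  by apply/seteqP; split=> x /=; rewrite subr_gt0.
- rewrite (_ : [set _ | _] = [set x | 0 < S (fun x => `|f x|) x - c]).
    by apply/measurable_gt0/measurable_funB => //; exact: measurable_on_measurable.
  by apply/seteqP; split=> x /=; rewrite subr_gt0.
- by apply: filterS (on_measurable_norm mff) => x /= ->.
Qed.

End extension.

(** * The induced action on every space L^q *)

Section extended_action.
Context d (X : measurableType d) (R : realType) (mu : probability X R).
Variables (G : groupType) (p : R) (p1 : (1 <= p%:E)%E).
Variable rho0 : G -> LspaceType mu p1 -> LspaceType mu p1.
Hypothesis rho0_action : isometric_lattice_action rho0.
Implicit Types (g h : G) (f u v w : X -> R) (a c : R).
Local Notation bd := (ae_bounded mu).
Local Notation mf := (measurable_fun setT).

Let S g f := on_measurable (rho0 g) f.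

Lemma action_unital g : unital_lattice_isometry (rho0 g).
Proof. by case: rho0_action => _ _ /(_ g)[? _ ? ?] ? ?; split. Qed.
Let uT := action_unital.

Lemma action_cancel g : cancel (rho0 g) (rho0 g^-1%g).
Proof.
case: rho0_action => r1 rM _ _ _ F.
by have := rM g^-1%g g; rewrite mulVg r1 => /(congr1 (fun k => k F)) /= <-.
Qed.

Lemma action_cancelV g : cancel (rho0 g^-1%g) (rho0 g).
Proof. by move=> F; have := action_cancel g^-1%g F; rewrite invgK. Qed.

Lemma action_automorphism g : unital_lattice_automorphism (rho0 g).
Proof.
by exists (rho0 g^-1%g); split; [exact: uT|exact: uT|exact: action_cancel|
  exact: action_cancelV].
Qed.
Let aT := action_automorphism.

(** The image of f under h is itself the fraction of the bounded functions
    T_h (num f) and T_h (den f), so applying g to it gives a fraction of images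
    under T_g T_h. *)
Lemma on_measurable_comp g h f : mf f ->
  \forall x \ae mu, S g (S h f) x = S (g * h)%g f x.
Proof.
move=> mff; have bn := ae_bounded_frac_num mu mff.
have bk := ae_bounded_frac_den mu mff.
have k0 : \forall x \ae mu, 0 < frac_den f x.
  by apply: nearW => x; exact: frac_den_gt0.
have fk : \forall x \ae mu, f x * frac_den f x = frac_num f x by exact: nearW.
apply: (on_measurableE (aT g)
  (u := on_bounded (rho0 h) (frac_num f)) (v := on_bounded (rho0 h) (frac_den f))).
- exact: measurable_on_measurable.
- exact: ae_bounded_on_bounded.
- exact: ae_bounded_on_bounded.
- exact: on_bounded_gt0.
- exact: (on_measurable_frac (aT h)).
- case: rho0_action => _ rM _ _ _.
  have E f' : on_bounded (rho0 g) (on_bounded (rho0 h) f') =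
      on_bounded (rho0 (g * h)%g) f' by rewrite on_bounded_comp /on_bounded rM.
  by rewrite !E; exact: (on_measurable_frac (aT (g * h)%g)).
Qed.

Lemma on_measurable1 f : mf f -> \forall x \ae mu, S 1%g f x = f x.
Proof.
move=> mff; have bn := ae_bounded_frac_num mu mff.
have bk := ae_bounded_frac_den mu mff.
apply: (on_measurableE (aT 1%g) mff bn bk).
- by apply: nearW => x; exact: frac_den_gt0.
- exact: nearW.
- rewrite /on_bounded; case: rho0_action => -> _ _ _ _.
  by apply: filterS2 (bd_LofE p1 bn) (bd_LofE p1 bk) => x -> ->.
Qed.

Section exponent.
Variables (q : R) (q1 : (1 <= q%:E)%E).
Local Notation L := (LspaceType mu q1).
Implicit Types F H : L.

Let qr1 : 1 <= q. Proof. by rewrite -lee_fin. Qed.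
Let q0 : 0 < q. Proof. by rewrite (lt_le_trans _ qr1). Qed.
Let mL F : mf F. Proof. exact: measurable_Lspace. Qed.
Let Sm g F : mf (S g F).
Proof. exact: measurable_on_measurable. Qed.

Definition extended_op g F : L := Lof mu q1 (S g F).

Let SM g f : mf f -> moment mu q (S g f) = moment mu q f.
Proof.
exact: (moment_on_measurable (aT g)).
Qed.

Let SL g F : S g F \in Lfun mu q%:E.
Proof.
apply/(mem_LfunP _ _ qr1); split; first exact: Sm.
by rewrite SM//; have /(mem_LfunP _ _ qr1)[] := Lspace_Lfun F.
Qed.

Lemma extended_opE g F : \forall x \ae mu, extended_op g F x = S g F x.
Proof. exact: LofE (SL g F). Qed.

Lemma eq_extended_op g F f : mf f -> (\forall x \ae mu, f x = F x) ->
  \forall x \ae mu, extended_op g F x = S g f x.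
Proof.
by move=> mff fF; rewrite /S (eq_on_measurable _ mff (mL F) fF); exact: extended_opE.
Qed.

Lemma Lspace_norm_eq (F H : L) : moment mu q F = moment mu q H -> `|F| = `|H|.
Proof.
rewrite -!Lspace_norm_moment => -[] /(powR_injective q0); apply;
  by rewrite nnegrE.
Qed.

Lemma extended_op_norm g F : `|extended_op g F| = `|F|.
Proof.
apply: Lspace_norm_eq; rewrite -(SM g (mL F)).
by apply: eq_moment; [exact: mL|exact: Sm|exact: extended_opE].
Qed.

Lemma extended_op_linear g : linear (extended_op g).
Proof.
move=> a F H; apply: Lspace_ae; have mF := mL F; have mH := mL H.
have maF : mf (fun x => a * F x) by exact: measurable_funM.
have D := on_measurableD (aT g) maF (mL H).
have Z := on_measurableZ (aT g) (mL F) a.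
have E : \forall x \ae mu, a * F x + H x = (a *: F + H) x.
  by apply: filterS2 (Lspace_addE (a *: F) H) (Lspace_scaleE a F) => x -> ->.
have mE : mf (fun x => a * F x + H x) by exact: measurable_funD.
have Lhs : \forall x \ae mu, extended_op g (a *: F + H) x = a * S g F x + S g H x.
  apply: filterS3 (eq_extended_op g mE E) D Z => x e1 e2 e3.
  by apply: (etrans e1); apply: (etrans e2); apply: congr2 e3 erefl.
have aG : \forall x \ae mu, (a *: extended_op g F) x = a * S g F x.
  apply: filterS2 (Lspace_scaleE a (extended_op g F)) (extended_opE g F) => x e1 e2.
  exact: etrans e1 (congr1 _ e2).
have Rhs : \forall x \ae mu,
    (a *: extended_op g F + extended_op g H) x = a * S g F x + S g H x.
  apply: filterS3 (Lspace_addE (a *: extended_op g F) (extended_op g H)) aG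
    (extended_opE g H) => x e1 e2 e3.
  exact: etrans e1 (congr2 _ e2 e3).
by apply: filterS2 Lhs Rhs => x e1 e2; exact: etrans e1 (esym e2).
Qed.

Lemma extended_op_meet g : Order.meet_morphism (extended_op g).
Proof.
move=> F H; apply: Lspace_ae; have mF := mL F; have mH := mL H.
have D := on_measurable_min (aT g) (mL F) (mL H).
have E : \forall x \ae mu, minr (F x) (H x) = Order.meet F H x.
  by apply: filterS (Lspace_meetE F H) => x ->.
have mE : mf (fun x => minr (F x) (H x)) by exact: measurable_minr.
have Rhs : \forall x \ae mu,
    Order.meet (extended_op g F) (extended_op g H) x = minr (S g F x) (S g H x).
  apply: filterS3 (Lspace_meetE (extended_op g F) (extended_op g H)) (extended_opE g F)
    (extended_opE g H) => x e1 e2 e3.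
  exact: etrans e1 (congr2 _ e2 e3).
apply: filterS3 (eq_extended_op g mE E) D Rhs => x e1 e2 e3.
exact: etrans e1 (etrans e2 (esym e3)).
Qed.

Lemma extended_op_join g : Order.join_morphism (extended_op g).
Proof.
move=> F H; apply: Lspace_ae; have mF := mL F; have mH := mL H.
have D := on_measurable_max (aT g) (mL F) (mL H).
have E : \forall x \ae mu, maxr (F x) (H x) = Order.join F H x.
  by apply: filterS (Lspace_joinE F H) => x ->.
have mE : mf (fun x => maxr (F x) (H x)) by exact: measurable_maxr.
have Rhs : \forall x \ae mu,
    Order.join (extended_op g F) (extended_op g H) x = maxr (S g F x) (S g H x).
  apply: filterS3 (Lspace_joinE (extended_op g F) (extended_op g H)) (extended_opE g F)
    (extended_opE g H) => x e1 e2 e3.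
  exact: etrans e1 (congr2 _ e2 e3).
apply: filterS3 (eq_extended_op g mE E) D Rhs => x e1 e2 e3.
exact: etrans e1 (etrans e2 (esym e3)).
Qed.

Lemma extended_op_cst g c : extended_op g (Lcst mu q1 c) = Lcst mu q1 c.
Proof.
apply: Lspace_ae.
have E : \forall x \ae mu, cst c x = Lcst mu q1 c x.
  by apply: filterS (LcstE mu q1 c) => x ->.
have mc : mf (cst c : X -> R) by exact: measurable_cst.
apply: filterS3 (eq_extended_op g mc E) E (on_measurable_cst (aT g) c).
by move=> x e1 e2 e3; exact: etrans e1 (etrans e3 e2).
Qed.

Lemma extended_opM g h F : extended_op (g * h)%g F = extended_op g (extended_op h F).
Proof.
apply: Lspace_ae.
have E : \forall x \ae mu, S h F x = extended_op h F x.
  by apply: filterS (extended_opE h F) => x ->.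
by apply: filterS3 (extended_opE (g * h)%g F) (eq_extended_op g (Sm h F) E)
  (on_measurable_comp g h (mL F)) => x e1 e2 e3;
  exact: etrans e1 (etrans (esym e3) (esym e2)).
Qed.

Lemma extended_op1 F : extended_op 1%g F = F.
Proof.
apply: Lspace_ae.
by apply: filterS2 (extended_opE 1%g F) (on_measurable1 (mL F)) => x; exact: etrans.
Qed.

Lemma extended_op_action : isometric_lattice_action extended_op.
Proof.
split.
- by apply/funext => F; exact: extended_op1.
- by move=> g h; apply/funext => F; exact: extended_opM.
- move=> g; split; [exact: extended_op_linear| |exact: extended_op_meet|
    exact: extended_op_join].
  by exists (extended_op g^-1%g) => F; rewrite -extended_opM ?mulVg ?mulgV extended_op1.
- exact: extended_op_norm.
- exact: extended_op_cst.
Qed.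

Lemma extended_op_bounded g F f : bd f -> (\forall x \ae mu, f x = F x) ->
  \forall x \ae mu, extended_op g F x = rho0 g (Lof mu p1 f) x.
Proof.
move=> bf fF; apply: filterS2 (eq_extended_op g bf.1 fF)
  (on_measurable_bounded (aT g) bf) => x.
exact: etrans.
Qed.

Lemma extended_op_agree g : agree_on_Linfty (rho0 g) (extended_op g).
Proof.
move=> F H /mem_LfunyP bF /Lspace_mfunP FH; apply/Lspace_mfunP.
by apply: filterS (extended_op_bounded g bF FH) => x; rewrite Lof_rep.
Qed.

End exponent.
End extended_action.

(** * Density of bounded functions and separability *)

Section norms.
Context d (X : measurableType d) (R : realType) (mu : probability X R).
Implicit Types (f h : X -> R) (e M c : R) (n : nat).
Local Notation bd := (ae_bounded mu).
Local Notation mf := (measurable_fun setT).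

Lemma Lspace_norm_lt p (p1 : (1 <= p%:E)%E) (F : LspaceType mu p1) e : 0 < e ->
  (moment mu p F < (e `^ p)%:E)%E -> `|F| < e.
Proof.
move=> e0; rewrite -Lspace_norm_moment lte_fin => h.
have p0 : 0 < p by rewrite (lt_le_trans ltr01)// -lee_fin.
by rewrite ltNge; apply/negP => eF; move: h;
  rewrite ltNge ge0_ler_powR ?nnegrE// ltW.
Qed.

Lemma Lspace_moment_lt p (p1 : (1 <= p%:E)%E) (F : LspaceType mu p1) e :
  `|F| < e -> (moment mu p F < (e `^ p)%:E)%E.
Proof.
move=> Fe; rewrite -Lspace_norm_moment lte_fin.
have p0 : 0 < p by rewrite (lt_le_trans ltr01)// -lee_fin.
by rewrite gt0_ltr_powR ?nnegrE// (le_trans _ (ltW Fe)).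
Qed.

Definition Lclip q (q1 : (1 <= q%:E)%E) n f : LspaceType mu q1 :=
  Lof mu q1 (clip n%:R f).

Lemma LclipE q (q1 : (1 <= q%:E)%E) n f : mf f ->
  \forall x \ae mu, Lclip q1 n f x = clip n%:R f x.
Proof. by move=> mff; apply: bd_LofE; exact: ae_bounded_clip. Qed.

Lemma Lclip_approx q (q1 : (1 <= q%:E)%E) (F : LspaceType mu q1) e : 0 < e ->
  exists n, `|F - Lclip q1 n F| < e.
Proof.
move=> e0; have q1r : 1 <= q by rewrite -lee_fin.
have [n Fn] := clip_approx q1r (Lspace_Lfun F) (powR_gt0 q e0).
exists n; apply: (Lspace_norm_lt e0); apply: le_lt_trans Fn.
rewrite le_eqVlt; apply/orP; left; apply/eqP; apply: eq_moment.
- exact: measurable_Lspace.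
- apply: measurable_funB; first exact: measurable_Lspace.
  by apply: measurable_clip; exact: measurable_Lspace.
- apply: filterS2 (Lspace_subE F (Lclip q1 n F))
    (LclipE q1 n (measurable_Lspace F)) => x e1 e2.
  by rewrite e1 e2.
Qed.

Section two_exponents.
Variables (p q : R) (p1 : (1 <= p%:E)%E) (q1 : (1 <= q%:E)%E).

(** The two classes belong to different spaces; the pointwise bound of H by F is
    what transfers smallness from one to the other. *)
Lemma bounded_norm_small M e : 0 < e -> exists2 eta, 0 < eta &
  forall (F : LspaceType mu p1) (H : LspaceType mu q1),
    (\forall x \ae mu, `|H x| <= M) -> (\forall x \ae mu, `|H x| <= `|F x|) ->
    `|F| < eta -> `|H| < e.
Proof.
move=> e0.
have p0 : 0 < p by rewrite (lt_le_trans ltr01)// -lee_fin.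
have q0 : 0 < q by rewrite (lt_le_trans ltr01)// -lee_fin.
have [eta eta0 Heta] := bounded_moment_small mu M q0 p0 (powR_gt0 q e0).
exists (eta `^ p^-1); first exact: powR_gt0.
move=> F H HM HF /Lspace_moment_lt.
rewrite -powRrM mulVf ?gt_eqF// powRr1 ?(ltW eta0)// => Feta.
apply: (Lspace_norm_lt e0); apply: (Heta _ (measurable_Lspace H) HM).
apply: le_lt_trans Feta; apply: (le_moment (ltW p0) _ _ HF);
  exact: measurable_Lspace.
Qed.

(** Truncation is 1-Lipschitz, so if G is close in L^p to a truncation of F, then
    their truncations are close in L^p and, being bounded by n, also in L^q. *)
Lemma separable_transfer :
  separable (LspaceType mu p1) -> separable (LspaceType mu q1).
Proof.
move=> [D cD dD].
exists [set Lclip q1 nF.1 nF.2 | nF in [set: nat] `*` D].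
  apply: (sub_countable (card_image_le _ _)).
  by apply: countableX.
move=> O [F OF] oO.
have /nbhs_ballP[e /= e0 eO] : nbhs F O by exact: open_nbhs_nbhs.
have e20 : 0 < e / 2 by rewrite divr_gt0.
have [n Fn] := Lclip_approx F e20.
have [eta eta0 small] := bounded_norm_small (n%:R + n%:R) e20.
have [G [/= BG DG]] : (ball (Lclip p1 n F) eta `&` D) !=set0.
  apply: dD; last exact: ball_open.
  by exists (Lclip p1 n F); exact: ballxx.
exists (Lclip q1 n G); split; last by exists (n, G).
apply: eO; rewrite -ball_normE /ball_/=.
rewrite (_ : F - _ = (F - Lclip q1 n F) + (Lclip q1 n F - Lclip q1 n G)); last first.
  by rewrite addrA subrK.
rewrite (le_lt_trans (ler_normD _ _))// (splitr e) ltrD//.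
have mF := measurable_Lspace F; have mG := measurable_Lspace G.
have cF := LclipE q1 n mF; have cG := LclipE q1 n mG; have cF' := LclipE p1 n mF.
have sH := Lspace_subE (Lclip q1 n F) (Lclip q1 n G).
have HE : \forall x \ae mu, (Lclip q1 n F - Lclip q1 n G) x =
    clip n%:R F x - clip n%:R G x.
  apply: filterS3 sH cF cG => x e1 e2 e3.
  by rewrite e1 e2 e3.
apply: (small (Lclip p1 n F - G)).
- apply: filterS HE => x ->; apply: le_trans (ler_normB _ _) _.
  by rewrite lerD// clip_le.
- apply: filterS3 HE (Lspace_subE (Lclip p1 n F) G) cF' => x e1 e2 e3.
  rewrite e1 e2 e3 -{1}(@clip_id _ _ _ n%:R (clip n%:R F)) ?clip_le//.
  exact: clip_lip.
- by move: BG; rewrite -ball_normE.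
Qed.

End two_exponents.
End norms.

(** * Pairing with a bounded function *)

Section pairing.
Context d (X : measurableType d) (R : realType) (mu : probability X R).
Variables (p : R) (p1 : (1 <= p%:E)%E).
Local Notation L := (LspaceType mu p1).
Variables (b : X -> R) (M : R).
Hypotheses (mb : measurable_fun setT b) (M0 : 0 <= M)
  (bM : forall x, `|b x| <= M).
Implicit Types F H : L.

Let mL F : measurable_fun setT F. Proof. exact: measurable_Lspace. Qed.

Lemma integrable_pairing F : mu.-integrable setT (EFin \o (fun x => F x * b x)).
Proof.
have F1 : (F : X -> R) \in Lfun mu 1.
  have muT : mu setT \is a fin_num by exact: fin_num_measure.
  exact: (Lfun_subset _ p1 muT p1 (Lspace_Lfun F)).
have iF := (Lfun1_integrable mu F).1 F1.
have iMF : mu.-integrable setT (EFin \o (fun x => M * F x)).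
  have := integrableZl measurableT M iF.
  by apply: eq_integrable => // x _ /=; rewrite EFinM.
apply: le_integrable iMF => //.
  by apply/measurable_EFinP; apply: measurable_funM => //; exact: mL.
move=> x _ /=; rewrite lee_fin !normrM mulrC (ger0_norm M0).
by rewrite ler_wpM2r.
Qed.

Lemma ae_eq_Rintegral (f g : X -> R) : measurable_fun setT f ->
  measurable_fun setT g -> (\forall x \ae mu, f x = g x) ->
  (\int[mu]_x f x = \int[mu]_x g x)%R.
Proof.
move=> mf mg fg; congr fine.
by apply: ae_eq_integral => //; [exact/measurable_EFinP|exact/measurable_EFinP|
  apply: filterS fg => x ->].
Qed.

Definition pairing_fun F : R^o := (\int[mu]_x (F x * b x))%R.

Let mP F : measurable_fun setT (fun x => F x * b x).
Proof. by apply: measurable_funM => //; exact: mL. Qed.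

Lemma pairing_is_linear : linear pairing_fun.
Proof.
move=> a F H; rewrite /pairing_fun.
have iF := integrable_pairing F; have iH := integrable_pairing H.
have iaF : mu.-integrable setT (EFin \o (fun x => a * (F x * b x))).
  have := integrableZl measurableT a iF.
  by apply: eq_integrable => // x _ /=; rewrite EFinM.
transitivity (\int[mu]_x (a * (F x * b x) + H x * b x))%R.
  apply: ae_eq_Rintegral; first exact: mP.
    apply: measurable_funD; last exact: mP.
    by apply: measurable_funM => //; exact: mP.
  apply: filterS2 (Lspace_addE (a *: F) H) (Lspace_scaleE a F) => x e1 e2.
  by rewrite e1 e2 mulrDl mulrA.
by rewrite RintegralD// RintegralZl.
Qed.

Definition pairing : {linear L -> R^o} := HB.pack_for {linear L -> R^o}
  pairing_fun (GRing.isLinear.Build R L R^o *:%R pairing_fun pairing_is_linear).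

(** From |F| <= 1 + |F|^p. This bound is not homogeneous, but a linear map that
    is bounded on balls is continuous. *)
Lemma pairing_bound F : `|pairing F| <= M * (1 + `|F| `^ p).
Proof.
have pr1 : 1 <= p by rewrite -lee_fin.
have iF := integrable_pairing F.
have iFp := Lfun_integrable pr1 (Lspace_Lfun F).
have i1 : mu.-integrable setT (EFin \o cst (1 : R)).
  exact: finite_measure_integrable_cst.
have i1F : mu.-integrable setT (EFin \o (fun x => cst 1 x + `|F x| `^ p)).
  exact: (integrableD measurableT i1 iFp).
have iM1F : mu.-integrable setT (EFin \o (fun x => M * (cst 1 x + `|F x| `^ p))).
  have := integrableZl measurableT M i1F.
  by apply: eq_integrable => // x _ /=; rewrite EFinM.
apply: le_trans (le_normr_Rintegral measurableT iF) _.
apply: (@le_trans _ _ (\int[mu]_x (M * (cst 1 x + `|F x| `^ p)))%R).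
  apply: le_Rintegral => //; first exact: (integrable_norm iF).
  move=> x _; rewrite normrM mulrC; apply: ler_pM => //=.
  have [F1|/ltW F1] := leP `|F x| 1; first by rewrite ler_wpDr// powR_ge0.
  by rewrite ler_wpDl// -{1}(powRr1 (normr_ge0 (F x))) ler_powR.
rewrite RintegralZl// RintegralD// Rintegral_cst// mul1r.
rewrite ler_wpM2l// le_eqVlt; apply/orP; left; apply/eqP; congr (_ + _).
  by rewrite [X in fine X](_ : _ = 1%E)//; exact: probability_setT.
by rewrite /Rintegral -/(moment mu p F) -Lspace_norm_moment.
Qed.

Lemma continuous_pairing : continuous pairing.
Proof.
apply: bounded_linear_continuous; apply/bounded_funP => r.
exists (M * (1 + r `^ p)) => F Fr; apply: le_trans (pairing_bound F) _.
have pr0 : 0 <= p by rewrite (le_trans ler01)// -lee_fin.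
rewrite ler_wpM2l// lerD2l ge0_ler_powR ?nnegrE//.
exact: le_trans Fr.
Qed.

End pairing.

(** * Weak and strong continuity *)

Section second_moment.
Context d (X : measurableType d) (R : realType) (mu : probability X R).
Implicit Types (u v : X -> R) (q M e : R).
Local Notation bd := (ae_bounded mu).
Local Notation mf := (measurable_fun setT).

Lemma ae_bounded_integrable u : bd u -> mu.-integrable setT (EFin \o u).
Proof. by move=> bu; apply/Lfun1_integrable; exact: ae_bounded_Lfun. Qed.

Lemma moment2_Rintegral u : bd u ->
  moment mu 2 u = (\int[mu]_x (u x * u x))%R%:E.
Proof.
move=> bu; have iu := ae_bounded_integrable (ae_boundedM bu bu).
rewrite /Rintegral fineK; last exact: integrable_fin_num.
by apply: eq_integral => x _; rewrite -[X in `|_| `^ X]/(2%:R)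
  powR_mulrn// real_normK ?num_real// expr2.
Qed.

Lemma moment2_sub u v : bd u -> bd v -> moment mu 2 u = moment mu 2 v ->
  moment mu 2 (fun x => u x - v x) =
  (2 * ((\int[mu]_x (v x * v x))%R - (\int[mu]_x (u x * v x))%R))%:E.
Proof.
move=> bu bv; rewrite !moment2_Rintegral//; last exact: ae_boundedB.
move=> [uv]; congr (_%:E).
have iuu := ae_bounded_integrable (ae_boundedM bu bu).
have ivv := ae_bounded_integrable (ae_boundedM bv bv).
have b2uv := ae_boundedZ 2 (ae_boundedM bu bv).
have iuv := ae_bounded_integrable (ae_boundedM bu bv).
have i2uv := ae_bounded_integrable b2uv.
have is_ := ae_bounded_integrable (ae_boundedB (ae_boundedM bu bu) b2uv).
transitivity (\int[mu]_x ((u x * u x - 2 * (u x * v x)) + v x * v x))%R.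
  by apply: eq_Rintegral => x _; ring.
rewrite RintegralD// RintegralB// RintegralZl// uv; ring.
Qed.

(** If u and v have equal L^2-norms, their squared L^2-distance is twice the
    defect of their inner product from <v, v>; boundedness then gives closeness
    in L^q. *)
Lemma bounded_inner_close q M e : 0 < q -> 0 < e -> exists2 eta, 0 < eta &
  forall u v, bd u -> bd v -> (\forall x \ae mu, `|u x| <= M) ->
    (\forall x \ae mu, `|v x| <= M) -> moment mu 2 u = moment mu 2 v ->
    `|(\int[mu]_x (v x * v x))%R - (\int[mu]_x (u x * v x))%R| < eta ->
    (moment mu q (fun x => (u x - v x)%R) < e%:E)%E.
Proof.
move=> q0 e0; have [eta eta0 small] :=
  bounded_moment_small mu (M + M) q0 (@ltr0n R 2) e0.
exists (eta / 2); first by rewrite divr_gt0.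
move=> u v bu bv uM vM uv close; apply: small.
- by case: (ae_boundedB bu bv).
- apply: filterS2 uM vM => x ux vx; apply: le_trans (ler_normB _ _) _.
  exact: lerD.
- rewrite (moment2_sub bu bv uv) lte_fin mulrC -ltr_pdivlMr//.
  exact: le_lt_trans (ler_norm _) close.
Qed.

End second_moment.

Lemma linear_sub (R : realType) (V W : normedModType R) (A : V -> W) :
  linear A -> forall x y, A (x - y) = A x - A y.
Proof.
by move=> lA x y; have := lA (-1) y x; rewrite !scaleN1r ![- _ + _]addrC.
Qed.

Lemma dist_lt_third (R : realType) (V : normedModType R) (a b c z : V) (e : R) :
  `|a - b| < e / 3 -> `|c - b| < e / 3 -> `|z - c| < e / 3 -> `|a - z| < e.
Proof.
move=> ab cb zc; have -> : a - z = (a - b) - (c - b) - (z - c).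
  by rewrite !opprB !addrA !subrK.
have -> : e = e / 3 + e / 3 + e / 3 by field.
rewrite (le_lt_trans (ler_normB _ _))// ltrD// (le_lt_trans (ler_normB _ _))//.
by rewrite ltrD.
Qed.

Section continuity.
Context d (X : measurableType d) (R : realType) (mu : probability X R).
Variables (G : groupType) (p0 : R) (p01 : (1 <= p0%:E)%E).
Variable rho0 : G -> LspaceType mu p01 -> LspaceType mu p01.
Hypothesis rho0_action : isometric_lattice_action rho0.
Variable tau : Topological G.
Let Gt : topologicalType := Topological.Pack tau.
Local Notation mf := (measurable_fun setT).
Local Notation rho q1 := (@extended_op _ _ _ _ _ _ _ rho0 _ q1).

(** V and W are the orbits of one truncation of F in L^p and in L^q. They are
    represented by the same functions, so weak continuity of V controls W in
    norm, and W stays within e / 3 of the orbit of F. *)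
Lemma weakly_continuous_strongly (p q : R) (p1 : (1 <= p%:E)%E) (q1 : (1 <= q%:E)%E) :
  weakly_continuous (rho p1 : Gt -> _ -> _) ->
  strongly_continuous (rho q1 : Gt -> _ -> _).
Proof.
move=> wc F g0; apply/cvgrPdist_lt => e e0.
have e30 : 0 < e / 3 by rewrite divr_gt0.
have q0 : 0 < q by rewrite (lt_le_trans ltr01)// -lee_fin.
have [n Fn] := Lclip_approx F e30.
pose f := clip n%:R F; have mF := measurable_Lspace F.
have n0 : (0 : R) <= n%:R by [].
have bf : ae_bounded mu f by exact: ae_bounded_clip.
pose V g := rho p1 g (Lclip mu p1 n F).
pose W g := rho q1 g (Lclip mu q1 n F).
have VE g : \forall x \ae mu, V g x = on_measurable (rho0 g) f x.
  apply: (eq_extended_op rho0_action) bf.1 _.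
  by apply: filterS (LclipE mu p1 n mF) => x ->.
have WE g : \forall x \ae mu, W g x = on_measurable (rho0 g) f x.
  apply: (eq_extended_op rho0_action) bf.1 _.
  by apply: filterS (LclipE mu q1 n mF) => x ->.
have Vn g : \forall x \ae mu, `|V g x| <= n%:R.
  have fn : \forall x \ae mu, `|f x| <= n%:R.
    by apply: nearW => x; exact: clip_le.
  apply: filterS3 (VE g) (on_measurable_bounded
    (action_automorphism rho0_action g) bf)
    (on_bounded_norm_le (action_unital rho0_action g) bf fn) => x e1 e2 e3.
  by rewrite e1 e2.
have bV g : ae_bounded mu (V g).
  by split; [exact: measurable_Lspace|exists n%:R].
have mV2 g : moment mu 2 (V g) = moment mu 2 f.
  have aT := action_automorphism rho0_action g.
  apply: etrans (moment_on_measurable aT (@ltr0n R 2) bf.1).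
  apply: eq_moment (VE g); first exact: measurable_Lspace.
  exact: measurable_on_measurable.
(* V g0 is bounded by n only a.e.; the pairing needs a bound at every point. *)
pose b := clip n%:R (V g0).
have mb : mf b by apply: measurable_clip; exact: measurable_Lspace.
have bE : \forall x \ae mu, b x = V g0 x.
  by apply: filterS (Vn g0) => x /clip_id.
pose phi := pairing mu p1 mb n0 (fun x => clip_le (V g0) x n0).
have phiE g : phi (V g) = (\int[mu]_x (V g x * V g0 x))%R.
  apply: ae_eq_Rintegral.
  - by apply: measurable_funM => //; exact: measurable_Lspace.
  - by apply: measurable_funM; exact: measurable_Lspace.
  - by apply: filterS bE => x ->.
have cphi : continuous (fun g : Gt => phi (V g)).
  by apply: wc; exact: continuous_pairing.
have [eta eta0 small] := bounded_inner_close mu n%:R q0 (powR_gt0 q e30).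
have small_W g : `|phi (V g0) - phi (V g)| < eta -> `|W g - W g0| < e / 3.
  rewrite !phiE => phig; apply: (Lspace_norm_lt e30).
  pose D x := V g x - V g0 x; have mD : mf D.
    by apply: measurable_funB; exact: measurable_Lspace.
  have dif : \forall x \ae mu, (W g - W g0) x = D x.
    have WV g' : \forall x \ae mu, W g' x = V g' x.
      by apply: filterS2 (WE g') (VE g') => x e1 e2; exact: etrans e1 (esym e2).
    exact: ae_eq_Lspace_sub (WV g) (WV g0).
  have momE := eq_moment q (measurable_Lspace (W g - W g0)) mD dif.
  have momV : moment mu 2 (V g) = moment mu 2 (V g0) := etrans (mV2 g) (esym (mV2 g0)).
  rewrite [ltLHS]momE.
  exact: (small _ _ (bV g) (bV g0) (Vn g) (Vn g0) momV phig).
have : \forall g \near (g0 : Gt), `|phi (V g0) - phi (V g)| < eta.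
  by move/cvgrPdist_lt : (cphi g0); apply.
apply: filterS => g /small_W Wg.
have close g' : `|rho q1 g' F - W g'| < e / 3.
  by rewrite -(linear_sub (extended_op_linear rho0_action g')) (extended_op_norm rho0_action).
exact: dist_lt_third (close g0) Wg (close g).
Qed.

Lemma strongly_continuous_weakly q (q1 : (1 <= q%:E)%E) :
  strongly_continuous (rho q1 : Gt -> _ -> _) ->
  weakly_continuous (rho q1 : Gt -> _ -> _).
Proof.
move=> sc phi cphi F g.
exact: (cvg_comp _ _ (sc F g) (cphi (rho q1 g F))).
Qed.

End continuity.

(** * Naturality *)

Section naturality.
Context d (X : measurableType d) (R : realType) (mu : probability X R).
Variables (G : groupType) (p0 : R) (p01 : (1 <= p0%:E)%E).
Variable rho0 : G -> LspaceType mu p01 -> LspaceType mu p01.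
Hypothesis rho0_action : isometric_lattice_action rho0.
Local Notation rho q1 := (@extended_op _ _ _ _ _ _ _ rho0 _ q1).

Lemma extended_op_bounded_operator q (q1 : (1 <= q%:E)%E) g : bounded_operator (rho q1 g).
Proof.
split; first exact: extended_op_linear.
by exists 1 => F; rewrite mul1r (extended_op_norm rho0_action).
Qed.

(** Truncations are dense in L^q, which gives uniqueness of the extension of an
    operator on bounded functions. *)
Lemma bounded_operator_ext q (q1 : (1 <= q%:E)%E)
    (A B : LspaceType mu q1 -> LspaceType mu q1) :
  bounded_operator A -> bounded_operator B ->
  (forall n (F : LspaceType mu q1), A (Lclip mu q1 n F) = B (Lclip mu q1 n F)) -> A = B.
Proof.
move=> [lA [M AM]] [lB [N BN]] AB; apply/funext => F.
apply/eqP; rewrite -subr_eq0 -normr_le0; apply/ler_addgt0Pl => e e0; rewrite addr0.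
pose C := `|M| + `|N| + 1.
have C0 : 0 < C by rewrite ltr_wpDl// addr_ge0.
have [n Fn] := Lclip_approx F (divr_gt0 e0 C0).
set H := Lclip mu q1 n F in Fn.
have -> : A F - B F = A (F - H) - B (F - H).
  rewrite (linear_sub lA) (linear_sub lB) (AB n F : A H = B H).
  by rewrite opprB addrA subrK.
apply: le_trans (ler_normB _ _) _.
apply: (@le_trans _ _ (C * `|F - H|)); last first.
  by rewrite mulrC -ler_pdivlMr// ltW.
apply: (@le_trans _ _ (`|M| * `|F - H| + `|N| * `|F - H|)).
  apply: lerD; [apply: le_trans (AM _) _|apply: le_trans (BN _) _];
    by rewrite ler_wpM2r// ler_norm.
by rewrite -mulrDl ler_wpM2r// lerDl.
Qed.

Lemma extended_op_natural : acts_naturally rho0 (fun q q1 => rho q1).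
Proof.
split.
  move=> g F /mem_LfunyP bF; apply/mem_LfunyP.
  have := ae_bounded_on_bounded (action_unital rho0_action g) bF.
  by rewrite /on_bounded Lof_rep.
move=> q q1 g; split.
  split; first exact: extended_op_bounded_operator.
  exact: extended_op_agree.
move=> A [bA aA]; apply: bounded_operator_ext => //.
  exact: extended_op_bounded_operator.
move=> n F; have mF := measurable_Lspace F.
have E1 := LclipE mu p01 n mF; have E2 := LclipE mu q1 n mF.
have cl : Lclip mu p01 n F = Lclip mu q1 n F :> {mfun_ mu, X >-> measurableTypeR R}.
  by apply/Lspace_mfunP; apply: filterS2 E1 E2 => x -> ->.
have bcl : (Lclip mu p01 n F : X -> R) \in Lfun mu +oo%E.
  apply/mem_LfunyP; split; first exact: measurable_Lspace.
  by exists n%:R; apply: filterS E1 => x ->; exact: clip_le.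
apply: Lspace_inj.
by rewrite -(aA _ _ bcl cl) (extended_op_agree rho0_action g bcl cl).
Qed.

End naturality.

Theorem corollary5p10 (d : measure_display) (X : measurableType d)
    (R : realType) (mu : probability X R) (G : groupType)
    (p0 : R) (p01 : (1 <= p0%:E)%E)
    (rho0 : G -> LspaceType mu p01 -> LspaceType mu p01) :
  isometric_lattice_action rho0 ->
  exists rho : forall (p : R) (p1 : (1 <= p%:E)%E),
      G -> LspaceType mu p1 -> LspaceType mu p1,
  [/\ acts_naturally rho0 rho,
      forall (p : R) (p1 : (1 <= p%:E)%E), isometric_lattice_action (rho p p1),
      (forall (p : R) (p1 : (1 <= p%:E)%E), separable (LspaceType mu p1)) \/
      (forall (p : R) (p1 : (1 <= p%:E)%E), ~ separable (LspaceType mu p1))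
    & forall tau : Topological G, group_topology tau ->
      let Gt : topologicalType := Topological.Pack tau in
      ((forall (p : R) (p1 : (1 <= p%:E)%E),
          strongly_continuous (rho p p1 : Gt -> _ -> _)) \/
       (forall (p : R) (p1 : (1 <= p%:E)%E),
          ~ strongly_continuous (rho p p1 : Gt -> _ -> _))) /\
      ((forall (p : R) (p1 : (1 <= p%:E)%E),
          weakly_continuous (rho p p1 : Gt -> _ -> _)) \/
       (forall (p : R) (p1 : (1 <= p%:E)%E),
          ~ weakly_continuous (rho p p1 : Gt -> _ -> _)))].
Proof.
move=> rho0_action.
(* Each of the three properties passes from one exponent to any other. *)
have all_or_none (P : forall p : R, (1 <= p%:E)%E -> Prop) :
    (forall p p1 q q1, P p p1 -> P q q1) ->
    (forall p p1, P p p1) \/ (forall p p1, ~ P p p1).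
  move=> PP; have [[p [p1 Pp]]|nP] := pselect (exists p p1, P p p1).
    by left => q q1; exact: PP Pp.
  by right => p p1 Pp; apply: nP; exists p, p1.
exists (fun p p1 => @extended_op _ _ _ _ _ _ _ rho0 _ p1); split.
- exact: extended_op_natural.
- by move=> p p1; exact: extended_op_action.
- apply: (all_or_none (fun p p1 => separable (LspaceType mu p1))).
  by move=> p p1 q q1; exact: separable_transfer.
- move=> tau _ Gt; split.
  + apply: (all_or_none (fun p p1 => strongly_continuous
      (@extended_op _ _ _ _ _ _ _ rho0 _ p1 : Gt -> _ -> _))).
    move=> p p1 q q1 sc.
    exact: (weakly_continuous_strongly rho0_action
      (strongly_continuous_weakly sc)).
  + apply: (all_or_none (fun p p1 => weakly_continuous
      (@extended_op _ _ _ _ _ _ _ rho0 _ p1 : Gt -> _ -> _))).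
    move=> p p1 q q1 wc; apply: strongly_continuous_weakly.
    exact: (weakly_continuous_strongly rho0_action wc).
Qed.
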